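(* Let $T>0$. For each $U\in BV_{LR}[0,T]$, the Loewner chain driven by $U$ admits a simple (i.e. injective) trace $\gamma:[0,T]\to\overline{\mathbb H}$ such that $\gamma_t\in\mathbb H$ for all $t\in(0,T]$.
   Context: $\mathbb H=\{z\in\mathbb C:\Im z>0\}$. $C_0[0,T]$ is the set of continuous functions $U:[0,T]\to\mathbb R$ with $U_0=0$. For a function $U$ and a closed interval $I$, $|||U|||_I$ denotes the total variation of $U$ on $I$ (the supremum over partitions of $I$ of the sum of absolute values of increments), and $|||U|||_t:=|||U|||_{[0,t]}$. $BV_{LR}[0,T]$ is the set of all $U\in C_0[0,T]$ with $|||U|||_T<\infty$ and such that for all $t\in(0,T]$, $\limsup_{s\to0+}\frac{|||U|||_{[t-s,t]}}{\sqrt s}<2$. Loewner chain: for $U\in C_0[0,T]$ and $z\in\overline{\mathbb H}\setminus\{0\}$, let $g_t(z)$ be the solution of $\partial_t g_t(z)=\frac{2}{g_t(z)-U_t}$, $g_0(z)=z$, on its maximal interval of existence $[0,T_z)$ ($T_z\in(0,\infty]$, with $T_z=\infty$ if the solution exists on all of $[0,T]$), and put $T_0=0$. Let $K_t=\{z\in\overline{\mathbb H}:T_z\le t\}$. The family $(K_t)_{t\in[0,T]}$ is the Loewner chain driven by $U$; $H_t:=\mathbb H\setminus K_t$ is simply connected and $g_t$ is a conformal map from $H_t$ onto $\mathbb H$. The chain admits a trace if there is a continuous curve $\gamma:[0,T]\to\overline{\mathbb H}$ with $\gamma_0=0$ such that for all $t\in[0,T]$, $H_t$ is the unbounded component of $\mathbb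 H\setminus\gamma[0,t]$; $\gamma$ is then called the trace of the chain (or the trace generated by $U$). *)

(* Defs.v *)
From HB Require Import structures.
From mathcomp Require Import all_boot all_order all_algebra.
From mathcomp Require Import complex.
From mathcomp Require Import all_classical all_reals all_analysis.

Set Implicit Arguments.
Unset Strict Implicit.
Unset Printing Implicit Defensive.

Import Order.TTheory GRing.Theory Num.Theory.
Import numFieldNormedType.Exports.

Local Open Scope classical_set_scope.
Local Open Scope ring_scope.
Local Open Scope complex_scope.

(* R[i] is a [numClosedFieldType], but the norm topology that the library
   attaches to abstract number fields is not inferred for this concrete type. *)
HB.instance Definition _ (R : realType) := GRing.ComAlgebra.copy R[i] R[i]^o.
HB.instance Definition _ (R : realType) := Vector.copy R[i] R[i]^o.
HB.instance Definition _ (R : realType) := NormedModule.copy R[i] R[i]^o.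

Definition upper_half_plane (R : realType) : set R[i] :=
  [set z | 0 < complex.Im z].
Arguments upper_half_plane R : clear implicits.

(* A function on [0, T] is represented by a total function on R of which only
   the values on [0, T] matter. *)
Definition C0 (R : realType) (T : R) : set (R -> R) :=
  [set U | {within `[0, T], continuous U} /\ U 0 = 0].

Definition BV_LR (R : realType) (T : R) : set (R -> R) :=
  [set U | [/\ C0 T U,
    (total_variation 0 T U < +oo)%E &
    forall t : R, 0 < t <= T ->
      (limf_esup (fun s : R =>
         total_variation (t - s) t U / (Num.sqrt s)%:E) 0^'+ < 2%:E)%E]].

(* The derivative is the limit of difference quotients along I, hence one-sided
   at the endpoints of I. Since 2 / 0 = 0, that g stays off U must be stated. *)
Definition loewner_solution (R : realType) (U : R -> R) (z : R[i])
    (I : set R) (g : R -> R[i]) : Prop :=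
  g 0 = z /\
  forall t : R, I t ->
    g t != (U t)%:C /\
    (fun s : R => (g s - g t) / (s - t)%:C) @ within I t^'
      --> 2 / (g t - (U t)%:C).

Definition loewner_lifetime (R : realType) (T : R) (U : R -> R) (z : R[i]) :
    \bar R :=
  if z == 0 then 0%E
  else if `[< exists g, loewner_solution U z `[0, T] g >] then +oo%E
  else ereal_sup [set S%:E | S in
    [set S : R | 0 <= S <= T /\ exists g, loewner_solution U z `[0, S[ g]].

Definition loewner_chain (R : realType) (T : R) (U : R -> R) (t : R) :
    set R[i] :=
  [set z | closure (upper_half_plane R) z /\
           (loewner_lifetime T U z <= t%:E)%E].

Definition is_component (X : topologicalType) (A C : set X) : Prop :=
  exists2 x, A x & C = connected_component A x.

Definition is_the_unbounded_component (R : realType) (A C : set R[i]) : Prop :=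
  [set D | is_component A D /\ ~ bounded_set D] = [set C].

Definition is_trace (R : realType) (T : R) (K : R -> set R[i])
    (gamma : R -> R[i]) : Prop :=
  [/\ {within `[0, T], continuous gamma},
      forall t : R, 0 <= t <= T -> closure (upper_half_plane R) (gamma t),
      gamma 0 = 0 &
      forall t : R, 0 <= t <= T ->
        is_the_unbounded_component
          (upper_half_plane R `\` gamma @` `[0, t])
          (upper_half_plane R `\` K t)].

(* Main.v *)
Require Import Defs.
From mathcomp Require Import all_boot all_order all_algebra.
From mathcomp Require Import complex.
From mathcomp Require Import all_classical all_reals all_analysis.
From mathcomp Require Import ring lra.

Import Order.TTheory GRing.Theory Num.Theory.
Import numFieldNormedType.Exports.

Set Implicit Arguments.
Unset Strict Implicit.
Unset Printing Implicit Defensive.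

Local Open Scope classical_set_scope.
Local Open Scope ring_scope.

(** A point [gamma t] of the trace is where the Loewner flow run backward from
    the singularity at time [t] arrives at time [0]. Write [Z = X + i Y] for a
    solution of the Loewner equation minus its driving function, so that
    [dX = 2 X / |Z|^2 dt - dU] and [dY = - 2 Y / |Z|^2 dt]. Run backward, the
    drift pulls [X] to [0], so [|X|] grows by at most the variation [v] of [U]
    ([loewner_path_re_le]). Moreover [d (Y^2 - X^2) = - 4 dt + 2 X dU], and
    integrating this with the previous bound gives, at distance [s] before [t]
    and for a final value close to the singularity, [Y^2 >= 4 s - v^2] up to a
    small error ([loewner_path_im_sqr_ge]). This is where the constant [2]
    enters: when [v <= c sqrt s] with [c < 2], the imaginary part is at least
    of order [sqrt s], whatever its final value, so that [Z] stays in a fixed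
    cone at every scale ([near_tip_scaling]).

    The backward flow contracts the hyperbolic metric, and in such a cone it
    does so at a rate at least a constant multiple of [1 / s]. Hence two backward flows started
    close to the singularity, at times close to [t], have merged at any
    earlier time ([near_tip_contraction]). All these flows therefore converge
    to one path that ends at the singularity ([tip_path_exists]), and its
    initial point is [gamma t]. No uniformity in [t] is required of [c]: the
    paths that end at the singularity at a time close to [t] pass close to the
    singularity near [t], so they start close to [gamma t], which is the
    continuity of [gamma] ([trace_continuous]).

    By uniqueness for the differential equation, the solution started at
    [gamma t] exists exactly up to time [t]; this gives injectivity. Conversely
    a solution that dies at time [t] comes arbitrarily close to the singularity
    before [t] ([dying_path_near_tip]), so it starts at [gamma t]. The half-plane
    minus the hull is thus the half-plane minus the curve; it is connected,
    being the image of the half-plane by the continuous backward flow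
    ([survivors_connected]), and it is unbounded, so it is the only unbounded
    component.

    The total variation of [U] enters only through a function [phi] whose
    increments dominate those of [U]. Integration against [dU] is replaced by a
    comparison of increments over short intervals ([le_of_straddle]). *)

Local Notation Re := complex.Re.
Local Notation Im := complex.Im.

(** * Derivatives along a set of times *)

Section Calculus.
Variable R : realType.
Implicit Types (f g F : R -> R) (I J : set R) (a b c d e x t : R).

(** A function is nondecreasing as soon as, around every point, its increments
    over short intervals containing that point are bounded below by arbitrarily
    small negative multiples of their lengths. No regularity is required. *)
Lemma le_of_straddle F a b : a <= b ->
  (forall x e, a <= x <= b -> 0 < e -> exists2 d, 0 < d &
    forall u v, a <= u -> u <= x -> x <= v -> v <= b ->
      x - u < d -> v - x < d -> F u - F v <= e * (v - u)) ->
  F a <= F b.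
Proof.
move=> ab H; apply/ler_addgt0Pr => e e0.
have [k k0 kE] : exists2 k, 0 < k & k * (b - a) <= e.
  exists (e / (b - a + 1)); first by rewrite divr_gt0//; lra.
  rewrite mulrAC ler_pdivrMr; [nra|lra].
pose S := [set x | a <= x <= b /\ F a - F x <= k * (x - a)].
have Sa : S a by split; [rewrite lexx|rewrite !subrr mulr0].
have Sub : has_ubound S by exists b => x [/andP[]].
have sa : a <= sup S by exact: ub_le_sup.
have sb : sup S <= b by apply: ge_sup; [exists a|move=> x [/andP[]]].
have := H (sup S) k; rewrite sa sb => /(_ isT k0)[d d0 Hd].
have [u Su us] : exists2 u, S u & sup S - d < u.
  by apply: sup_gt; [exists a|lra].
have us' : u <= sup S by exact: ub_le_sup.
case: Su => /andP[au ub] Fu.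
pose v := Num.min b (sup S + d / 2).
have [vb vs] : v <= b /\ v <= sup S + d / 2 by rewrite /v; split; rewrite ge_min lexx ?orbT.
have sv : sup S <= v by rewrite le_min sb; lra.
have Fv : F u - F v <= k * (v - u) by apply: Hd => //; lra.
have Sv : S v by split; [apply/andP; split; lra|lra].
have /= vs' : v <= sup S by exact: ub_le_sup.
have vE : v = b.
  have [h|h] := leP b (sup S + d / 2); first by rewrite /v min_l.
  by exfalso; move: vs'; rewrite /v min_r ?(ltW h)// => h'; lra.
by case: Sv; rewrite vE => _; lra.
Qed.

(** [f] has derivative [d] at [x] along [I]: the difference quotient converges
    along the points of [I], hence from one side only at an endpoint of an
    interval. It is a record, and not an abbreviation, so that applying a lemma
    does not unfold it into an inclusion of filters. *)
Record der_in I f x d : Prop := DerIn {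
  der_in_cvg_quotient : (fun s => (f s - f x) / (s - x)) @ within I x^' --> d }.

(** First-order expansion along [I]. *)
Lemma der_inP I f x d : der_in I f x d <->
  forall e, 0 < e -> exists2 k, 0 < k &
    forall y, I y -> `|y - x| < k -> `|f y - f x - d * (y - x)| <= e * `|y - x|.
Proof.
split=> [[/cvgrPdist_le H] e e0|H].
- have [k /= k0 Hk] := H e e0; exists k => // y Iy yx.
  have [->|yne] := eqVneq y x; first by rewrite !subrr mulr0 subr0 normr0 mulr0.
  have y0 : 0 < `|y - x| by rewrite normr_gt0 subr_eq0.
  have : `|d - (f y - f x) / (y - x)| <= e by apply: Hk => //; rewrite /ball/= distrC.
  by rewrite distrC -(ler_pM2r y0) -normrM mulrBl divfK ?subr_eq0.
- constructor; apply/cvgrPdist_le => e e0.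
  have [k k0 Hk] := H e e0; exists k => //= y; rewrite /ball/= => yx yne Iy.
  have y0 : 0 < `|y - x| by rewrite normr_gt0 subr_eq0.
  rewrite distrC -(ler_pM2r y0) -normrM mulrBl divfK ?subr_eq0//.
  by apply: Hk => //; rewrite distrC.
Qed.

Lemma der_in_sub I J f x d : I `<=` J -> der_in J f x d -> der_in I f x d.
Proof.
move=> IJ /der_inP H; apply/der_inP => e /H[k k0 Hk]; exists k => // y /IJ; exact: Hk.
Qed.

Lemma der_in_eq I f x d d' : d = d' -> der_in I f x d -> der_in I f x d'.
Proof. by move=> ->. Qed.

(** Being a derivative along [I] only depends on the germ of [I] and [f]. *)
Lemma der_in_local I J f g x d r : 0 < r ->
  (forall y, I y -> `|y - x| < r -> J y /\ g y = f y) -> g x = f x ->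
  der_in J f x d -> der_in I g x d.
Proof.
move=> r0 IJ gf /der_inP H; apply/der_inP => e /H[k k0 Hk].
exists (Num.min k r); first by rewrite lt_min k0.
move=> y Iy; rewrite lt_min => /andP[yk yr].
by have [Jy ->] := IJ _ Iy yr; rewrite gf; exact: Hk.
Qed.

Lemma der_in_ext I f g x d : (forall y, I y -> g y = f y) -> I x ->
  der_in I f x d -> der_in I g x d.
Proof.
move=> fg Ix; apply: (@der_in_local _ _ _ _ _ _ 1) => //; last exact: fg.
by move=> y Iy _; split => //; exact: fg.
Qed.

Lemma der_in_cvg I f x d : der_in I f x d -> f @ within I (nbhs x) --> f x.
Proof.
move=> /der_inP H; apply/cvgrPdist_lt => e e0.
have [k k0 Hk] := H 1 ltr01.
have c0 : 0 < `|d| + 1 by rewrite ltr_wpDl.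
exists (Num.min k (e / (`|d| + 1))) => /=; first by rewrite lt_min k0 divr_gt0.
move=> y; rewrite /ball/= distrC lt_min => /andP[yk ye] Iy.
rewrite distrC; apply: le_lt_trans (_ : (`|d| + 1) * `|y - x| < _); last first.
  by rewrite mulrC -ltr_pdivlMr.
have := Hk y Iy yk; rewrite mul1r => h.
have -> : f y - f x = (f y - f x - d * (y - x)) + d * (y - x) by ring.
by apply: le_trans (ler_normD _ _) _; rewrite (normrM d); lra.
Qed.

Lemma cvg_withinP I f x l : f @ within I (nbhs x) --> l <->
  forall e, 0 < e -> exists2 k, 0 < k &
    forall y, I y -> `|y - x| < k -> `|f y - l| < e.
Proof.
rewrite cvgrPdist_lt; split => H e e0.
- have [k /= k0 Hk] := H e e0; exists k => // y Iy yx.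
  by rewrite distrC; apply: Hk => //; rewrite /ball/= distrC.
- have [k k0 Hk] := H e e0; exists k => //= y; rewrite /ball/= => yx Iy.
  by rewrite distrC; apply: Hk => //; rewrite distrC.
Qed.

Lemma der_in_cst I c x : der_in I (fun=> c) x 0.
Proof. by apply/der_inP => e e0; exists 1 => // y _ _; rewrite subrr mul0r subr0 normr0 mulr_ge0// ltW. Qed.

Lemma der_in_id I x : der_in I id x 1.
Proof. by apply/der_inP => e e0; exists 1 => // y _ _; rewrite mul1r subrr normr0 mulr_ge0// ltW. Qed.

Lemma der_inD I f g x a b : der_in I f x a -> der_in I g x b ->
  der_in I (fun t => f t + g t) x (a + b).
Proof.
move=> [df] [dg]; constructor.
under eq_fun => s do rewrite opprD addrACA mulrDl.
exact: cvgD df dg.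
Qed.

Lemma der_inN I f x a : der_in I f x a -> der_in I (fun t => - f t) x (- a).
Proof.
move=> [df]; constructor.
under eq_fun => s do rewrite -opprD mulNr.
exact: cvgN df.
Qed.

Lemma der_inB I f g x a b : der_in I f x a -> der_in I g x b ->
  der_in I (fun t => f t - g t) x (a - b).
Proof. by move=> df dg; apply: der_inD => //; exact: der_inN. Qed.

Lemma within_dnbhs I x (f : R -> R) (l : R) :
  f @ within I (nbhs x) --> l -> f @ within I x^' --> l.
Proof.
move=> /cvg_withinP H; apply/cvgrPdist_lt => e /H[k k0 Hk].
exists k => //= y; rewrite /ball/= => yx _ Iy.
by rewrite distrC; apply: Hk => //; rewrite distrC.
Qed.

Lemma der_inM I f g x a b : der_in I f x a -> der_in I g x b ->
  der_in I (fun t => f t * g t) x (a * g x + f x * b).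
Proof.
move=> df dg; constructor.
rewrite (_ : (fun _ => _) = fun s => (f s - f x) / (s - x) * g s +
   f x * ((g s - g x) / (s - x))); last first.
  by apply/funext => s; ring.
apply: cvgD; last by apply: cvgM; [exact: cvg_cst|case: dg].
apply: cvgM; first by case: df.
exact/within_dnbhs/(der_in_cvg dg).
Qed.

Lemma der_inMl I f x a c : der_in I f x a -> der_in I (fun t => c * f t) x (c * a).
Proof.
move=> df; apply: der_in_eq (der_inM (der_in_cst I c x) df).
by rewrite mul0r add0r.
Qed.

Lemma der_inV I f x a : f x != 0 -> der_in I f x a ->
  der_in I (fun t => (f t)^-1) x (- a / f x ^+ 2).
Proof.
move=> fx df; constructor.
have cf := within_dnbhs (der_in_cvg df).
have H : (fun s => - ((f s - f x) / (s - x)) * ((f s)^-1 * (f x)^-1)) @ within I x^'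
    --> - a / f x ^+ 2.
  rewrite expr2 invfM; apply: cvgM; first by case: df => df; exact: cvgN df.
  by apply: cvgM; [apply: cvgV|exact: cvg_cst].
apply: cvg_trans H; apply: near_eq_cvg.
have : \forall s \near within I x^', f s != 0.
  move/cvgrPdist_lt: cf => /(_ `|f x|); rewrite normr_gt0 => /(_ fx).
  apply: filterS => s; apply: contraTneq => ->.
  by rewrite subr0 ltxx.
rewrite near_withinE; apply: filterS2; last exact: (nbhs_dnbhs_neq x).
move=> s sx fs Is; have := fs Is => {}fs.
by field; rewrite fs fx subr_eq0 sx.
Qed.

Lemma der_in_is_derive I f x d : is_derive x 1 f d -> der_in I f x d.
Proof.
move=> [df dE]; apply: (@der_in_sub _ setT) => //.
move: df => /cvg_ex[l /= Hl]; have ld : l = d.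
  by rewrite -dE; apply/esym/cvg_lim.
subst l; apply/der_inP => e e0.
move/cvgrPdist_le: Hl => /(_ e e0)[k /= k0 Hk]; exists k => // y _ yx.
have [->|yne] := eqVneq y x; first by rewrite !subrr mulr0 subr0 normr0 mulr0.
have y0 : 0 < `|y - x| by rewrite normr_gt0 subr_eq0.
have : `|d - (y - x)^-1 * (f y - f x)| <= e.
  have := Hk (y - x); rewrite /ball/= sub0r normrN subr_eq0 => /(_ yx yne).
  by rewrite /GRing.scale/= mulr1 subrK.
by rewrite distrC -(ler_pM2r y0) -normrM mulrBl [X in `|X - _|]mulrAC mulVf ?mul1r ?subr_eq0.
Qed.

Lemma der_in_expR I c x : der_in I (fun t => expR (c * t)) x (c * expR (c * x)).
Proof.
have h : is_derive x (1 : R) (fun t => c * t) c.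
  by apply: (is_derive_eq (is_deriveZ c (is_derive_id x 1))); exact: mulr1.
by rewrite mulrC; apply: der_in_is_derive.
Qed.

Lemma der_in_ndecr f (f' : R -> R) a b : a <= b ->
  (forall x, a <= x <= b -> der_in `[a, b] f x (f' x)) ->
  (forall x, a <= x <= b -> 0 <= f' x) -> f a <= f b.
Proof.
move=> ab df f0; apply: le_of_straddle => // x e xab e0.
have /der_inP/(_ e e0)[k k0 Hk] := df x xab.
exists k => // u v au ux xv vb uk vk; have d0 := f0 x xab.
have := Hk v; rewrite /= in_itv/= ger0_norm; last lra.
have -> : a <= v <= b by apply/andP; split; lra.
move=> /(_ isT vk); rewrite ler_norml => /andP[h1 _].
have := Hk u; rewrite /= in_itv/= ler0_norm; last lra.
have -> : a <= u <= b by apply/andP; split; lra.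
rewrite opprB => /(_ isT uk); rewrite ler_norml => /andP[_ h2]; nra.
Qed.

Lemma der_in_nincr f (f' : R -> R) a b : a <= b ->
  (forall x, a <= x <= b -> der_in `[a, b] f x (f' x)) ->
  (forall x, a <= x <= b -> f' x <= 0) -> f b <= f a.
Proof.
move=> ab df f0; rewrite -lerN2.
apply: (@der_in_ndecr (fun t => - f t) (fun t => - f' t)) => // x xab.
  by apply: der_inN; exact: df.
by rewrite oppr_ge0; exact: f0.
Qed.

End Calculus.

(** * Antiderivatives and the Cauchy-Lipschitz theorem *)

Section Picard.
Variable R : realType.
Implicit Types (f g F : R -> R) (I J : set R) (a b c d e x t : R).

Lemma der_in_eq_incr f g (h : R -> R) a b : a <= b ->
  (forall x, a <= x <= b -> der_in `[a, b] f x (h x)) ->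
  (forall x, a <= x <= b -> der_in `[a, b] g x (h x)) ->
  f b - f a = g b - g a.
Proof.
move=> ab df dg.
have dd x : a <= x <= b -> der_in `[a, b] (fun t => f t - g t) x 0.
  by move=> xab; rewrite -(subrr (h x)); apply: der_inB; [exact: df|exact: dg].
have h1 := @der_in_ndecr _ _ (fun=> 0) _ _ ab dd (fun _ _ => lexx 0).
have h2 := @der_in_nincr _ _ (fun=> 0) _ _ ab dd (fun _ _ => lexx 0).
lra.
Qed.

(** A continuous function on the whole line has a global antiderivative: the
    integrals from [- n] are glued after subtracting their values at [0]. *)
Lemma antiderivative f : continuous f ->
  exists F, forall x, der_in setT F x (f x).
Proof.
move=> cf.
pose G n x := \int[lebesgue_measure]_(t in `[- n, x]) f t.
have dG n x : - n < x -> der_in setT (G n) x (f x).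
  move=> nx; apply: der_in_is_derive.
  have [] := @continuous_FTC1_closed R f (- n) x (x + 1) _ _ nx (cf x).
  - by rewrite ltrDl.
  - apply: continuous_compact_integrable; first exact: segment_compact.
    exact: continuous_subspaceT.
  - by move=> d1 d2; apply: DeriveDef; [exact: d1|rewrite -derive1E; exact: d2].
have GE n m x : 0 < n -> 0 < m -> - n < x -> - m < x ->
    G n x - G n 0 = G m x - G m 0.
  move=> n0 m0 nx mx; have [x0|x0] := leP 0 x.
    by apply: (@der_in_eq_incr _ _ f) => // y /andP[y0 yx];
      apply: (@der_in_sub _ _ setT) => //; apply: dG; lra.
  suff : G n 0 - G n x = G m 0 - G m x by lra.
  by apply: (@der_in_eq_incr _ _ f) => [|y /andP[y0 yx]|y /andP[y0 yx]];
    rewrite ?(ltW x0)//; apply: (@der_in_sub _ _ setT) => //; apply: dG; lra.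
exists (fun x => G (`|x| + 1) x - G (`|x| + 1) 0) => x.
have x0 := normr_ge0 x; have xx : - x <= `|x| by rewrite -normrN ler_norm.
have E y : `|y - x| < 1 ->
    G (`|y| + 1) y - G (`|y| + 1) 0 = G (`|x| + 2) y - G (`|x| + 2) 0.
  move=> yx; have y0 := normr_ge0 y; have yy : - y <= `|y| by rewrite -normrN ler_norm.
  by apply: GE; move: yx; rewrite ?ltr_norml => /andP[? ?]; lra.
apply: (@der_in_local _ _ setT (fun y => G (`|x| + 2) y - G (`|x| + 2) 0) _ _ _ 1).
- by [].
- by move=> y _ /E.
- by apply: E; rewrite subrr normr0.
- rewrite -[f x]subr0; apply: der_inB; last exact: der_in_cst.
  by apply: dG; lra.
Qed.

(** A sequence with a geometric Cauchy modulus converges, with the same modulus. *)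
Lemma geometric_cauchy_lim (u : nat -> R) c :
  (forall n m, (n <= m)%N -> `|u m - u n| <= c * 2^-1 ^+ n) ->
  exists l, forall n, `|l - u n| <= c * 2^-1 ^+ n.
Proof.
move=> H; pose S := range (fun n => u n - c * 2^-1 ^+ n).
have ubS n : ubound S (u n + c * 2^-1 ^+ n).
  move=> _ [m _ <-].
  have c0 k : 0 <= c * 2^-1 ^+ k by rewrite (le_trans _ (H k k _)).
  have cn := c0 n; have cm := c0 m.
  have [nm|mn] := leqP n m.
    by have := H _ _ nm; rewrite ler_norml => /andP[? ?]; lra.
  by have := H _ _ (ltnW mn); rewrite ler_norml => /andP[? ?]; lra.
exists (sup S) => n; rewrite ler_distl; apply/andP; split.
  by apply: ub_le_sup; [exists (u 0%N + c * 2^-1 ^+ 0); exact: ubS|exists n].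
by apply: ge_sup; [exists (u n - c * 2^-1 ^+ n), n|exact: ubS].
Qed.

(** Mean value inequality, valid on both sides of [t0]. *)
Lemma normr_le_of_der f g (f' g' : R -> R) t0 t :
  (forall x, der_in setT f x (f' x)) -> (forall x, der_in setT g x (g' x)) ->
  (forall x, `|f' x| <= g' x) -> f t0 = 0 -> g t0 = 0 -> `|f t| <= `|g t|.
Proof.
move=> df dg fg f0 g0.
have mono s1 s2 : s1 <= s2 -> `|f s2 - f s1| <= g s2 - g s1.
  move=> s12; rewrite ler_norml; apply/andP; split.
    suff : g s1 + f s1 <= g s2 + f s2 by lra.
    apply: (@der_in_ndecr _ (fun t => g t + f t) (fun t => g' t + f' t)) => // x _.
      by apply: (@der_in_sub _ _ setT) => //; exact: der_inD.
    by have := fg x; rewrite ler_norml => /andP[]; lra.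
  suff : g s1 - f s1 <= g s2 - f s2 by lra.
  apply: (@der_in_ndecr _ (fun t => g t - f t) (fun t => g' t - f' t)) => // x _.
    by apply: (@der_in_sub _ _ setT) => //; exact: der_inB.
  by have := fg x; rewrite ler_norml => /andP[]; lra.
have [tt|tt] := leP t0 t.
  have := mono _ _ tt; rewrite f0 g0 !subr0 => h; exact: le_trans h (ler_norm _).
have := mono _ _ (ltW tt); rewrite f0 g0 !sub0r normrN => h.
by apply: le_trans h _; rewrite -[leRHS]normrN ler_norm.
Qed.

(** [x -> expR (c (x - t0)) + expR (- c (x - t0))] is the weight for which the
    integration operator from [t0], in both time directions, has norm at most
    [1 / c]. *)
Definition cosh_weight c t0 t : R := expR (c * (t - t0)) + expR (- c * (t - t0)).

Lemma cosh_weight_ge1 c t0 t : 1 <= cosh_weight c t0 t.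
Proof.
have h1 := expR_ge1Dx (c * (t - t0)); have h2 := expR_ge1Dx (- c * (t - t0)).
by rewrite /cosh_weight; have := mulNr c (t - t0); lra.
Qed.

Lemma der_in_expRB c t0 x :
  der_in setT (fun t => expR (c * (t - t0))) x (c * expR (c * (x - t0))).
Proof.
have E t : expR (c * (t - t0)) = expR (- (c * t0)) * expR (c * t).
  by rewrite -expRD; congr expR; ring.
rewrite (_ : (fun t => _) = fun t => expR (- (c * t0)) * expR (c * t)); last exact/funext.
by rewrite E mulrCA; apply: der_inMl; exact: der_in_expR.
Qed.

Lemma integral_weight_bound f g F G c m t0 t : 0 < c -> 0 <= m ->
  (forall x, der_in setT F x (f x)) -> (forall x, der_in setT G x (g x)) ->
  (forall x, `|f x - g x| <= m * cosh_weight c t0 x) -> F t0 = G t0 ->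
  `|F t - G t| <= m / c * cosh_weight c t0 t.
Proof.
move=> c0 m0 dF dG fg FG.
pose S := fun t => m / c * (expR (c * (t - t0)) - expR (- c * (t - t0))).
have : `|F t - G t| <= `|S t|.
  apply: (@normr_le_of_der (fun t => F t - G t) S (fun t => f t - g t)
    (fun t => m * cosh_weight c t0 t) t0) => //.
  - by move=> x; exact: der_inB.
  - move=> x; have dS := der_inB (der_in_expRB c t0 x) (der_in_expRB (- c) t0 x).
    apply: (der_in_eq _ (der_inMl (m / c) dS)).
    by rewrite /cosh_weight; field; rewrite gt_eqF.
  - by rewrite FG subrr.
  - by rewrite /S !subrr !mulr0 subrr mulr0.
move=> h; apply: le_trans h _.
rewrite /S normrM ger0_norm ?divr_ge0 ?(ltW c0)// ler_wpM2l ?divr_ge0 ?(ltW c0)//.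
rewrite /cosh_weight; have := expR_gt0 (c * (t - t0)); have := expR_gt0 (- c * (t - t0)).
by move=> h1 h2; rewrite ler_norml; apply/andP; split; lra.
Qed.

(** Cauchy-Lipschitz theorem, global in time, for a bounded planar field that
    is continuous in time and Lipschitz in space uniformly in time. *)
Theorem cauchy_lipschitz (F1 F2 : R -> R -> R -> R) (L B t0 x0 y0 : R) :
  0 < L -> 0 <= B ->
  (forall t x y x' y', `|F1 t x y - F1 t x' y'| <= L * (`|x - x'| + `|y - y'|)) ->
  (forall t x y x' y', `|F2 t x y - F2 t x' y'| <= L * (`|x - x'| + `|y - y'|)) ->
  (forall t x y, `|F1 t x y| <= B) -> (forall t x y, `|F2 t x y| <= B) ->
  (forall p q : R -> R, continuous p -> continuous q ->
     continuous (fun t => F1 t (p t) (q t)) /\ continuous (fun t => F2 t (p t) (q t))) ->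
  exists p q : R -> R, [/\ p t0 = x0, q t0 = y0,
    (forall t, der_in setT p t (F1 t (p t) (q t))) &
    (forall t, der_in setT q t (F2 t (p t) (q t)))].
Proof.
move=> L0 B0 L1 L2 B1 B2 C.
have Jex f : exists F, F t0 = 0 /\ (continuous f -> forall x, der_in setT F x (f x)).
  have [cf|ncf] := pselect (continuous f); last by exists (fun=> 0).
  have [F dF] := antiderivative cf; exists (fun t => F t - F t0); split; first by rewrite subrr.
  by move=> _ x; rewrite -[f x]subr0; apply: der_inB => //; exact: der_in_cst.
(* the antiderivative vanishing at [t0] *)
pose J f := sval (cid (Jex f)).
have J0 f : J f t0 = 0 by rewrite /J; case: cid => F [].
have dJ f : continuous f -> forall x, der_in setT (J f) x (f x).
  by rewrite /J; case: cid => F [].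
pose N1 (pq : (R -> R) * (R -> R)) t := F1 t (pq.1 t) (pq.2 t).
pose N2 (pq : (R -> R) * (R -> R)) t := F2 t (pq.1 t) (pq.2 t).
pose step pq := ((fun t => x0 + J (N1 pq) t), (fun t => y0 + J (N2 pq) t)).
pose z n := iter n step ((fun=> x0), (fun=> y0)).
(* with this weight, each component of [step] is Lipschitz with constant 1/4 *)
pose c := 4 * L; have c0 : 0 < c by rewrite /c; lra.
pose w := cosh_weight c t0; have w1 t : 1 <= w t by exact: cosh_weight_ge1.
pose lipB f := forall s t, `|f s - f t| <= B * `|s - t|.
have lipc f : lipB f -> continuous f.
  move=> lf x; apply/cvgrPdist_lt => e e0.
  exists (e / (B + 1)) => /=; first by rewrite divr_gt0//; lra.
  move=> y; rewrite /ball/= ltr_pdivlMr; last lra.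
  by move=> h; apply: le_lt_trans (lf _ _) _; have := normr_ge0 (x - y); nra.
have derlip f (f' : R -> R) : (forall x, der_in setT f x (f' x)) ->
    (forall x, `|f' x| <= B) -> lipB f.
  move=> df fB s t; have -> : B * `|s - t| = `|B * (s - t)|.
    by rewrite normrM (ger0_norm B0).
  apply: (@normr_le_of_der (fun s => f s - f t) (fun s => B * (s - t)) f' (fun=> B) t) => //.
  - by move=> x; rewrite -[f' x]subr0; apply: der_inB => //; exact: der_in_cst.
  - move=> x; apply: (der_in_eq _ (der_inMl B (der_inB (der_in_id _ _) (der_in_cst _ t _)))).
    by rewrite subr0 mulr1.
  - by rewrite subrr.
  - by rewrite subrr mulr0.
have derstep pq : continuous pq.1 -> continuous pq.2 ->
    (forall x, der_in setT (step pq).1 x (N1 pq x)) /\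
    (forall x, der_in setT (step pq).2 x (N2 pq x)).
  move=> c1 c2; have [d1 d2] := C _ _ c1 c2; split=> x.
    by rewrite -[N1 pq x]add0r; apply: der_inD; [exact: der_in_cst|exact: dJ].
  by rewrite -[N2 pq x]add0r; apply: der_inD; [exact: der_in_cst|exact: dJ].
have lipz n : lipB (z n).1 /\ lipB (z n).2.
  elim: n => [|n [l1 l2]].
    by split=> s t /=; rewrite subrr normr0 mulr_ge0.
  have [d1 d2] := derstep _ (lipc _ l1) (lipc _ l2).
  by split; [apply: (derlip _ _ d1) => x; exact: B1|apply: (derlip _ _ d2) => x; exact: B2].
have dz n : (forall x, der_in setT (z n.+1).1 x (N1 (z n) x)) /\
    (forall x, der_in setT (z n.+1).2 x (N2 (z n) x)).
  by have [l1 l2] := lipz n; apply: derstep; exact: lipc.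
have z0 n : (z n).1 t0 = x0 /\ (z n).2 t0 = y0.
  by case: n => [//|n]; rewrite /= !J0 !addr0.
pose M := B / c.
have M0 : 0 <= M by rewrite divr_ge0// ltW.
have Mn n : 0 <= M * 2^-1 ^+ n by rewrite mulr_ge0// exprn_ge0// invr_ge0.
(* consecutive iterates get twice closer at each step *)
have zz n t : `|(z n.+1).1 t - (z n).1 t| <= M * 2^-1 ^+ n * w t /\
              `|(z n.+1).2 t - (z n).2 t| <= M * 2^-1 ^+ n * w t.
  elim: n t => [|n IH] t.
    have [d1 d2] := dz 0%N; rewrite expr0 mulr1.
    have dc (v : R) x : der_in setT (fun=> v) x ((fun=> 0) x) by exact: der_in_cst.
    have [q1 q2] := z0 1%N.
    split; [apply: (@integral_weight_bound (N1 (z 0%N)) (fun=> 0) _ (fun=> x0) c B t0 t c0 B0 d1)|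
            apply: (@integral_weight_bound (N2 (z 0%N)) (fun=> 0) _ (fun=> y0) c B t0 t c0 B0 d2)] => //.
      by move=> x; rewrite subr0; apply: le_trans (B1 _ _ _) _; rewrite ler_peMr//; exact: w1.
    by move=> x; rewrite subr0; apply: le_trans (B2 _ _ _) _; rewrite ler_peMr//; exact: w1.
  have [d1 d2] := dz n.+1; have [d3 d4] := dz n.
  have [q1 q2] := z0 n.+2; have [q3 q4] := z0 n.+1.
  have -> : M * 2^-1 ^+ n.+1 = (L * (2 * (M * 2^-1 ^+ n))) / c.
    by rewrite exprS /c; field; rewrite gt_eqF.
  have m0 : 0 <= L * (2 * (M * 2^-1 ^+ n)) by rewrite mulr_ge0 ?(ltW L0)// mulr_ge0.
  have LE x : L * (`|(z n.+1).1 x - (z n).1 x| + `|(z n.+1).2 x - (z n).2 x|) <=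
      L * (2 * (M * 2^-1 ^+ n)) * w x.
    by rewrite -mulrA ler_pM2l//; have [] := IH x; lra.
  split; [apply: (integral_weight_bound _ c0 m0 d1 d3)|apply: (integral_weight_bound _ c0 m0 d2 d4)] => //.
  - by move=> x; apply: le_trans (LE x); exact: L1.
  - by rewrite q1 q3.
  - by move=> x; apply: le_trans (LE x); exact: L2.
  - by rewrite q2 q4.
(* a bound on consecutive terms is a Cauchy bound *)
have geo (u : nat -> R) a : (forall n, `|u n.+1 - u n| <= a * 2^-1 ^+ n) ->
    forall n m, (n <= m)%N -> `|u m - u n| <= 2 * a * 2^-1 ^+ n.
  move=> H n m nm.
  suff : `|u m - u n| <= 2 * a * (2^-1 ^+ n - 2^-1 ^+ m).
    move=> h; apply: le_trans h _.
    have a0 : 0 <= a by have := H 0%N; rewrite expr0 mulr1; exact: le_trans.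
    rewrite ler_wpM2l//; first lra.
    by rewrite gerBl exprn_ge0// invr_ge0.
  rewrite -(subnK nm); elim: (m - n)%N => [|k IH]; first by rewrite add0n !subrr normr0 mulr0.
  rewrite addSn; have := H (k + n)%N; rewrite exprS.
  have -> : u (k + n).+1 - u n = (u (k + n).+1 - u (k + n)%N) + (u (k + n)%N - u n) by ring.
  by move=> h; apply: le_trans (ler_normD _ _) _; lra.
have lim1 t : exists l, forall n, `|l - (z n).1 t| <= 2 * (M * w t) * 2^-1 ^+ n.
  apply: geometric_cauchy_lim; apply: geo => n.
  by rewrite mulrAC; have [] := zz n t.
have lim2 t : exists l, forall n, `|l - (z n).2 t| <= 2 * (M * w t) * 2^-1 ^+ n.
  apply: geometric_cauchy_lim; apply: geo => n.
  by rewrite mulrAC; have [] := zz n t.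
pose p t := sval (cid (lim1 t)); pose q t := sval (cid (lim2 t)).
have pE t n : `|p t - (z n).1 t| <= 2 * (M * w t) * 2^-1 ^+ n.
  by rewrite /p; case: cid.
have qE t n : `|q t - (z n).2 t| <= 2 * (M * w t) * 2^-1 ^+ n.
  by rewrite /q; case: cid.
have small (a b : R) : 0 <= b -> (forall n, a <= b * 2^-1 ^+ n) -> a <= 0.
  move=> b0 H; rewrite leNgt; apply/negP => a0.
  have [n Hn] : exists n, b * 2^-1 ^+ n < a.
    have /cvgrPdist_lt/(_ (a / (b + 1))) : (2^-1 : R) ^+ n @[n --> \oo] --> (0 : R).
      by apply: cvg_expr; rewrite ger0_norm ?invr_ge0// invf_lt1// ltr1n.
    have ab : 0 < a / (b + 1) by rewrite divr_gt0//; lra.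
    move=> /(_ ab)[n _ /(_ n)/=]; rewrite leqnn sub0r normrN => /(_ isT).
    rewrite ger0_norm ?exprn_ge0 ?invr_ge0// ltr_pdivlMr; last lra.
    move=> h; exists n; have : (0 : R) <= 2^-1 ^+ n by rewrite exprn_ge0// invr_ge0.
    by nra.
  by have := H n; lra.
have liplim (u : R -> R) (v : nat -> R -> R) : (forall n, lipB (v n)) ->
    (forall t n, `|u t - v n t| <= 2 * (M * w t) * 2^-1 ^+ n) -> lipB u.
  move=> lv uv s t.
  suff : `|u s - u t| - B * `|s - t| <= 0 by lra.
  apply: (small _ (2 * (M * w t) + 2 * (M * w s))).
    by have := w1 t; have := w1 s; nra.
  move=> n; rewrite mulrDl.
  have := uv s n; have := uv t n; have := lv n s t.
  have -> : u s - u t = (u s - v n s) - (u t - v n t) + (v n s - v n t) by ring.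
  have := ler_normD ((u s - v n s) - (u t - v n t)) (v n s - v n t).
  have := ler_normB (u s - v n s) (u t - v n t).
  by lra.
have cp : continuous p by apply: lipc; apply: liplim pE => n; have [] := lipz n.
have cq : continuous q by apply: lipc; apply: liplim qE => n; have [] := lipz n.
have [dP dQ] := derstep (p, q) cp cq.
have closeE n t : L * (`|(p, q).1 t - (z n).1 t| + `|(p, q).2 t - (z n).2 t|) <=
      L * (4 * (M * 2^-1 ^+ n)) * w t.
  by rewrite -mulrA ler_pM2l//=; have := pE t n; have := qE t n; lra.
have m0 n : 0 <= L * (4 * (M * 2^-1 ^+ n)) by rewrite mulr_ge0 ?(ltW L0)// mulr_ge0.
(* the limit is a fixed point of [step] *)
have PE : (step (p, q)).1 = p.
  apply/funext => t; apply/eqP; rewrite -subr_eq0 -normr_le0.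
  apply: (small _ (2 * (M * w t))) => [|n]; first by have := w1 t; nra.
  have [d3 d4] := dz n; have [q3 q4] := z0 n.+1.
  have := pE t n.+1.
  have H : `|(step (p, q)).1 t - (z n.+1).1 t| <= L * (4 * (M * 2^-1 ^+ n)) / c * w t.
    apply: (integral_weight_bound _ c0 (m0 n) dP d3) => //.
      by move=> x; apply: le_trans (closeE n x); exact: L1.
    by rewrite q3 /= J0 addr0.
  have E : L * (4 * (M * 2^-1 ^+ n)) / c * w t = M * w t * 2^-1 ^+ n.
    by rewrite /c; field; rewrite gt_eqF.
  rewrite E in H; rewrite exprS => h.
  have -> : (step (p, q)).1 t - p t = ((step (p, q)).1 t - (z n.+1).1 t) - (p t - (z n.+1).1 t) by ring.
  by apply: le_trans (ler_normB _ _) _; lra.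
have QE : (step (p, q)).2 = q.
  apply/funext => t; apply/eqP; rewrite -subr_eq0 -normr_le0.
  apply: (small _ (2 * (M * w t))) => [|n]; first by have := w1 t; nra.
  have [d3 d4] := dz n; have [q3 q4] := z0 n.+1.
  have := qE t n.+1.
  have H : `|(step (p, q)).2 t - (z n.+1).2 t| <= L * (4 * (M * 2^-1 ^+ n)) / c * w t.
    apply: (integral_weight_bound _ c0 (m0 n) dQ d4) => //.
      by move=> x; apply: le_trans (closeE n x); exact: L2.
    by rewrite q4 /= J0 addr0.
  have E : L * (4 * (M * 2^-1 ^+ n)) / c * w t = M * w t * 2^-1 ^+ n.
    by rewrite /c; field; rewrite gt_eqF.
  rewrite E in H; rewrite exprS => h.
  have -> : (step (p, q)).2 t - q t = ((step (p, q)).2 t - (z n.+1).2 t) - (q t - (z n.+1).2 t) by ring.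
  by apply: le_trans (ler_normB _ _) _; lra.
exists p, q; split.
- by rewrite -PE /= J0 addr0.
- by rewrite -QE /= J0 addr0.
- by move: dP; rewrite PE.
- by move: dQ; rewrite QE.
Qed.

End Picard.

(** * Paths of the Loewner flow in the upper half-plane *)

Section Paths.
Variable R : realType.
Implicit Types (f g F U A Y phi : R -> R) (I J : set R) (a b c d e s t u x y m : R).

(** Real and imaginary parts of the velocity [2 / (z - u)] at [z = x + i m]. *)
Definition velx u x m : R := 2 * (x - u) / ((x - u) ^+ 2 + m ^+ 2).
Definition vely u x m : R := - (2 * m / ((x - u) ^+ 2 + m ^+ 2)).

Lemma sqr_sum_gt0 x m : 0 < m -> 0 < x ^+ 2 + m ^+ 2.
Proof. by move=> m0; rewrite ltr_wpDl ?sqr_ge0// exprn_gt0. Qed.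

(** The inversion [w -> 1 / w], up to conjugation, is Lipschitz with constant
    [1 / a^2] on the half-plane of imaginary part at least [a]. *)
Lemma inversion_lip (p m q n a : R) : 0 < a -> a <= m -> a <= n ->
  `|p / (p ^+ 2 + m ^+ 2) - q / (q ^+ 2 + n ^+ 2)| <= (`|p - q| + `|m - n|) / a ^+ 2 /\
  `|m / (p ^+ 2 + m ^+ 2) - n / (q ^+ 2 + n ^+ 2)| <= (`|p - q| + `|m - n|) / a ^+ 2.
Proof.
move=> a0 am an.
have m0 : 0 < m by lra. have n0 : 0 < n by lra.
have N0 := sqr_sum_gt0 p m0; have M0 := sqr_sum_gt0 q n0.
set N := p ^+ 2 + m ^+ 2 in N0 *; set M := q ^+ 2 + n ^+ 2 in M0 *.
have a2 : 0 < a ^+ 2 by rewrite exprn_gt0.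
have Na : a ^+ 2 <= N by rewrite /N; have := sqr_ge0 p; nra.
have Ma : a ^+ 2 <= M by rewrite /M; have := sqr_ge0 q; nra.
have id : (p / N - q / M) ^+ 2 + (m / N - n / M) ^+ 2 =
    ((p - q) ^+ 2 + (m - n) ^+ 2) / (N * M).
  by rewrite /N /M; field; rewrite -/N -/M !gt_eqF.
set r := (`|p - q| + `|m - n|) / a ^+ 2.
have r0 : 0 <= r by rewrite divr_ge0 ?(ltW a2)// addr_ge0.
have le : (p / N - q / M) ^+ 2 + (m / N - n / M) ^+ 2 <= r ^+ 2.
  rewrite id ler_pdivrMr ?mulr_gt0//.
  have -> : r ^+ 2 * (N * M) = (`|p - q| + `|m - n|) ^+ 2 * (N / a ^+ 2 * (M / a ^+ 2)).
    by rewrite /r; field; rewrite gt_eqF.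
  have N1 : 1 <= N / a ^+ 2 by rewrite ler_pdivlMr// mul1r.
  have M1 : 1 <= M / a ^+ 2 by rewrite ler_pdivlMr// mul1r.
  have NM1 : 1 <= N / a ^+ 2 * (M / a ^+ 2) by nra.
  have -> : (p - q) ^+ 2 = `|p - q| ^+ 2 by rewrite real_normK ?num_real.
  have -> : (m - n) ^+ 2 = `|m - n| ^+ 2 by rewrite real_normK ?num_real.
  have h1 := normr_ge0 (p - q); have h2 := normr_ge0 (m - n).
  apply: (@le_trans _ _ ((`|p - q| + `|m - n|) ^+ 2)); first nra.
  by rewrite ler_peMr// sqr_ge0.
split; rewrite -ler_sqr ?nnegrE ?normr_ge0// real_normK ?num_real//.
  by apply: le_trans le; rewrite lerDl sqr_ge0.
by apply: le_trans le; rewrite lerDr sqr_ge0.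
Qed.

Lemma vel_lip u x y x' y' a : 0 < a -> a <= y -> a <= y' ->
  `|velx u x y - velx u x' y'| <= 2 / a ^+ 2 * (`|x - x'| + `|y - y'|) /\
  `|vely u x y - vely u x' y'| <= 2 / a ^+ 2 * (`|x - x'| + `|y - y'|).
Proof.
move=> a0 ay ay'; have [h1 h2] := inversion_lip (x - u) (x' - u) a0 ay ay'.
have E : x - u - (x' - u) = x - x' by ring.
rewrite E in h1 h2.
split.
  have -> : velx u x y - velx u x' y' = 2 * ((x - u) / ((x - u) ^+ 2 + y ^+ 2) -
    (x' - u) / ((x' - u) ^+ 2 + y' ^+ 2)) by rewrite /velx; ring.
  by rewrite normrM ger0_norm//; lra.
have -> : vely u x y - vely u x' y' = - (2 * (y / ((x - u) ^+ 2 + y ^+ 2) -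
    y' / ((x' - u) ^+ 2 + y' ^+ 2))) by rewrite /vely; ring.
by rewrite normrN normrM ger0_norm//; lra.
Qed.

Lemma vel_bound u x y a : 0 < a -> a <= y ->
  `|velx u x y| <= 2 / a /\ `|vely u x y| <= 2 / a.
Proof.
move=> a0 ay; have y0 : 0 < y by lra.
have N0 := sqr_sum_gt0 (x - u) y0.
have h (r : R) : `|r| * y <= (x - u) ^+ 2 + y ^+ 2 ->
    `|2 * r / ((x - u) ^+ 2 + y ^+ 2)| <= 2 / a.
  move=> hr; rewrite !normrM ger0_norm// normfV (gtr0_norm N0).
  rewrite -mulrA ler_pM2l// ler_pdivrMr// mulrC ler_pdivlMr//.
  by apply: le_trans hr; rewrite ler_wpM2l.
split; first apply: h.
  have : `|x - u| ^+ 2 = (x - u) ^+ 2 by rewrite real_normK ?num_real.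
  by move=> <-; have := normr_ge0 (x - u); nra.
rewrite /vely normrN; apply: h; rewrite gtr0_norm//.
by have := sqr_ge0 (x - u); nra.
Qed.

(** A solution [A + i Y] along [I] of the Loewner equation driven by [U], staying
    in the open upper half-plane. *)
Definition loewner_path U I A Y : Prop := forall t, I t ->
  [/\ 0 < Y t, der_in I A t (velx (U t) (A t) (Y t)) &
      der_in I Y t (vely (U t) (A t) (Y t))].

(** Same equation with the imaginary part replaced by its maximum with [a]
    in the velocity, which for [0 < a] makes the field bounded and Lipschitz. *)
Definition truncated_path U a I A Y : Prop := forall t, I t ->
  der_in I A t (velx (U t) (A t) (Num.max (Y t) a)) /\
  der_in I Y t (vely (U t) (A t) (Num.max (Y t) a)).

Lemma loewner_path_sub U I J A Y : I `<=` J -> loewner_path U J A Y -> loewner_path U I A Y.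
Proof.
by move=> IJ h t It; have [? ? ?] := h t (IJ _ It); split => //; exact: (der_in_sub IJ).
Qed.

Lemma truncated_path_sub U a I J A Y :
  I `<=` J -> truncated_path U a J A Y -> truncated_path U a I A Y.
Proof.
by move=> IJ h t It; have [? ?] := h t (IJ _ It); split => //; exact: (der_in_sub IJ).
Qed.

Lemma loewner_path_truncated U a I A Y : (forall t, I t -> a <= Y t) ->
  loewner_path U I A Y -> truncated_path U a I A Y.
Proof. by move=> aY h t It; have [? ? ?] := h t It; rewrite max_l ?aY. Qed.

Lemma truncated_path_loewner U a I A Y : 0 < a -> (forall t, I t -> a <= Y t) ->
  truncated_path U a I A Y -> loewner_path U I A Y.
Proof.
move=> a0 aY h t It; have := h t It; rewrite max_l ?aY// => -[? ?]; split => //.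
by apply: lt_le_trans (aY t It).
Qed.

Lemma maxr_lip x y a : `|Num.max x a - Num.max y a| <= `|x - y|.
Proof.
move: (ler_norm (x - y)) (ler_norm (- (x - y))); rewrite normrN => h1 h2.
have h3 := normr_ge0 (x - y); rewrite ler_norml.
by case: (leP x a) => ?; case: (leP y a) => ?; apply/andP; split; lra.
Qed.

Lemma minr_lip x y a : `|Num.min x a - Num.min y a| <= `|x - y|.
Proof.
move: (ler_norm (x - y)) (ler_norm (- (x - y))); rewrite normrN => h1 h2.
have h3 := normr_ge0 (x - y); rewrite ler_norml.
by case: (leP x a) => ?; case: (leP y a) => ?; apply/andP; split; lra.
Qed.

Lemma truncated_path_exists U a t0 x0 y0 : continuous U -> 0 < a ->
  exists A Y, [/\ A t0 = x0, Y t0 = y0 & truncated_path U a setT A Y].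
Proof.
move=> cU a0.
have mx y : a <= Num.max y a by rewrite le_max lexx orbT.
have L0 : 0 < 2 / a ^+ 2 by rewrite divr_gt0// exprn_gt0.
have B0 : 0 <= 2 / a by rewrite divr_ge0// ltW.
have [|||||A [Y [At Yt dA dY]]] := @cauchy_lipschitz R
  (fun t x y => velx (U t) x (Num.max y a)) (fun t x y => vely (U t) x (Num.max y a))
  _ _ t0 x0 y0 L0 B0.
- move=> t x y x' y'; have [h _] := vel_lip (U t) x x' a0 (mx y) (mx y').
  by apply: le_trans h _; rewrite ler_pM2l// lerD2l maxr_lip.
- move=> t x y x' y'; have [_ h] := vel_lip (U t) x x' a0 (mx y) (mx y').
  by apply: le_trans h _; rewrite ler_pM2l// lerD2l maxr_lip.
- by move=> t x y; have [] := vel_bound (U t) x a0 (mx y).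
- by move=> t x y; have [] := vel_bound (U t) x a0 (mx y).
- move=> p q cp cq.
  have cm t : (fun t => Num.max (q t) a) @ t --> Num.max (q t) a.
    apply/cvgrPdist_lt => e e0; have /cvgrPdist_lt/(_ e e0) := cq t.
    by apply: filterS => s; apply: le_lt_trans; exact: maxr_lip.
  have cX t : (fun t => p t - U t) @ t --> p t - U t by apply: cvgB; [exact: cp|exact: cU].
  have N0 t : (p t - U t) ^+ 2 + (Num.max (q t) a) ^+ 2 != 0.
    by rewrite gt_eqF// sqr_sum_gt0//; exact: lt_le_trans (mx _).
  have cN t : (fun t => ((p t - U t) ^+ 2 + (Num.max (q t) a) ^+ 2)^-1) @ t -->
      ((p t - U t) ^+ 2 + (Num.max (q t) a) ^+ 2)^-1.
    apply: cvgV => //.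
    rewrite (_ : (fun s => _) = fun s => (p s - U s) * (p s - U s) +
      Num.max (q s) a * Num.max (q s) a); last by apply/funext => s; rewrite !expr2.
    by rewrite !expr2; apply: cvgD; [exact: cvgM (cX t) (cX t)|exact: cvgM (cm t) (cm t)].
  split=> t.
    apply: cvgM; last exact: cN.
    by apply: cvgM; [exact: cvg_cst|exact: cX].
  apply: cvgN; apply: cvgM; last exact: cN.
  by apply: cvgM; [exact: cvg_cst|exact: cm].
by exists A, Y; split => // t _; exact: (conj (dA t) (dY t)).
Qed.

(** Gronwall lemma for vanishing data, in both time directions. *)
Lemma gronwall0 f (f' : R -> R) K a b r r' : a <= b -> a <= r <= b -> a <= r' <= b ->
  (forall x, a <= x <= b -> der_in `[a, b] f x (f' x)) ->
  (forall x, a <= x <= b -> `|f' x| <= K * f x) -> f r = 0 -> f r' <= 0.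
Proof.
move=> ab /andP[ar rb] /andP[ar' rb'] df fK fr.
have [rr|rr] := leP r r'.
  have H : expR (- K * r') * f r' <= expR (- K * r) * f r.
    apply: (@der_in_nincr _ (fun t => expR (- K * t) * f t)
      (fun x => - K * expR (- K * x) * f x + expR (- K * x) * f' x)) => //.
      move=> x /andP[rx xr]; apply: (@der_in_sub _ _ `[a, b]).
        by move=> y; rewrite /= !in_itv/= => /andP[? ?]; apply/andP; split; lra.
      by apply: der_inM; [exact: der_in_expR|apply: df; apply/andP; split; lra].
    move=> x /andP[rx xr]; have := expR_gt0 (- K * x).
    have xab : a <= x <= b by apply/andP; split; lra.
    have := fK x xab; rewrite ler_norml => /andP[_ h] h2.
    have -> : - K * expR (- K * x) * f x + expR (- K * x) * f' x =
      - (expR (- K * x) * (K * f x - f' x)) by ring.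
    by rewrite oppr_le0 mulr_ge0 ?(ltW h2)//; lra.
  by move: H; rewrite fr mulr0 pmulr_rle0// expR_gt0.
have H : expR (K * r') * f r' <= expR (K * r) * f r.
  apply: (@der_in_ndecr _ (fun t => expR (K * t) * f t)
    (fun x => K * expR (K * x) * f x + expR (K * x) * f' x)) => //; first exact: ltW.
    move=> x /andP[rx xr]; apply: (@der_in_sub _ _ `[a, b]).
      by move=> y; rewrite /= !in_itv/= => /andP[? ?]; apply/andP; split; lra.
    by apply: der_inM; [exact: der_in_expR|apply: df; apply/andP; split; lra].
  move=> x /andP[rx xr]; have := expR_gt0 (K * x).
  have xab : a <= x <= b by apply/andP; split; lra.
  have := fK x xab; rewrite ler_norml => /andP[h _] h2.
  have -> : K * expR (K * x) * f x + expR (K * x) * f' x =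
    expR (K * x) * (K * f x + f' x) by ring.
  by rewrite mulr_ge0 ?(ltW h2)//; lra.
by move: H; rewrite fr mulr0 pmulr_rle0// expR_gt0.
Qed.

Lemma der_in_sqr I f x d : der_in I f x d -> der_in I (fun t => f t ^+ 2) x (2 * f x * d).
Proof.
move=> df; rewrite (_ : (fun t => _) = fun t => f t * f t); last by apply/funext => t; rewrite expr2.
by apply: der_in_eq (der_inM df df); ring.
Qed.

Lemma sqr_sum_le0 x y : x ^+ 2 + y ^+ 2 <= 0 -> x = 0 /\ y = 0.
Proof.
move=> h; have := sqr_ge0 x; have := sqr_ge0 y => h1 h2.
by split; apply/eqP; rewrite -sqrf_eq0; apply/eqP; lra.
Qed.

(** Two paths that agree at one time [r] agree at any other time [r'], earlier or
    later. *)
Lemma truncated_path_unique U a A1 Y1 A2 Y2 s t r r' : 0 < a -> s <= t ->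
  truncated_path U a `[s, t] A1 Y1 -> truncated_path U a `[s, t] A2 Y2 ->
  s <= r <= t -> s <= r' <= t -> A1 r = A2 r -> Y1 r = Y2 r ->
  A1 r' = A2 r' /\ Y1 r' = Y2 r'.
Proof.
move=> a0 st p1 p2 rst rst' Ar Yr.
have mx y : a <= Num.max y a by rewrite le_max lexx orbT.
pose L := 2 / a ^+ 2; have L0 : 0 < L by rewrite divr_gt0// exprn_gt0.
pose P := fun t => (A1 t - A2 t) ^+ 2 + (Y1 t - Y2 t) ^+ 2.
pose P' := fun t => 2 * (A1 t - A2 t) * (velx (U t) (A1 t) (Num.max (Y1 t) a) -
   velx (U t) (A2 t) (Num.max (Y2 t) a)) + 2 * (Y1 t - Y2 t) *
   (vely (U t) (A1 t) (Num.max (Y1 t) a) - vely (U t) (A2 t) (Num.max (Y2 t) a)).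
suff /sqr_sum_le0[] : P r' <= 0 by move=> h1 h2; lra.
apply: (@gronwall0 P P' (4 * L) s t r r') => //; last first.
- by rewrite /P Ar Yr !subrr expr0n addr0.
- move=> x xst.
  have [h1 h2] := vel_lip (U x) (A1 x) (A2 x) a0 (mx (Y1 x)) (mx (Y2 x)).
  have h3 := maxr_lip (Y1 x) (Y2 x) a.
  move: h1 h2; rewrite -/L.
  set v := velx _ _ _ - _; set w := vely _ _ _ - _ => h1 h2.
  set p := A1 x - A2 x in h1 h2 *; set q := Y1 x - Y2 x in h1 h2 h3 *.
  have {}h1 : `|v| <= L * (`|p| + `|q|) by apply: le_trans h1 _; rewrite ler_pM2l// lerD2l.
  have {}h2 : `|w| <= L * (`|p| + `|q|) by apply: le_trans h2 _; rewrite ler_pM2l// lerD2l.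
  rewrite /P' /P -/p -/q -/v -/w.
  have -> : p ^+ 2 = `|p| ^+ 2 by rewrite real_normK ?num_real.
  have -> : q ^+ 2 = `|q| ^+ 2 by rewrite real_normK ?num_real.
  apply: le_trans (ler_normD _ _) _.
  rewrite !normrM (@ger0_norm _ 2)//.
  have p0 := normr_ge0 p; have q0 := normr_ge0 q.
  have k1 : `|p| * `|v| <= `|p| * (L * (`|p| + `|q|)) by rewrite ler_wpM2l.
  have k2 : `|q| * `|w| <= `|q| * (L * (`|p| + `|q|)) by rewrite ler_wpM2l.
  have k3 : 0 <= L * (`|p| - `|q|) ^+ 2 by rewrite mulr_ge0 ?sqr_ge0// ltW.
  by nra.
- move=> x xst; have xst' : `[s, t]%classic x by rewrite /= in_itv/=.
  have [d1 d2] := p1 x xst'; have [d3 d4] := p2 x xst'.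
  apply: der_inD; [exact: (der_in_sqr (der_inB d1 d3))|exact: (der_in_sqr (der_inB d2 d4))].
Qed.

Lemma mem_itvcc s t x : s <= x <= t -> `[s, t]%classic x.
Proof. by rewrite /= in_itv. Qed.

Lemma loewner_path_im_nincr U A Y s t : s <= t -> loewner_path U `[s, t] A Y -> Y t <= Y s.
Proof.
move=> st p; apply: (@der_in_nincr _ Y (fun x => vely (U x) (A x) (Y x))) => // x xst.
  by have [] := p x (mem_itvcc xst).
have [y0 _ _] := p x (mem_itvcc xst).
by rewrite /vely oppr_le0 divr_ge0 ?(ltW (sqr_sum_gt0 _ y0))// mulr_ge0// ltW.
Qed.

Lemma itv_subset a b c d : a <= c -> d <= b -> `[c, d]%classic `<=` `[a, b]%classic.
Proof. by move=> ac db x; rewrite /= !in_itv/= => /andP[? ?]; apply/andP; split; lra. Qed.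

Lemma loewner_path_im_ge U A Y s t u : s <= u <= t -> loewner_path U `[s, t] A Y -> Y t <= Y u.
Proof.
move=> /andP[su ut] p; apply: (@loewner_path_im_nincr U A Y) => //.
by apply: loewner_path_sub p; exact: itv_subset.
Qed.

Lemma loewner_path_unique U A1 Y1 A2 Y2 s t r r' : s <= t ->
  loewner_path U `[s, t] A1 Y1 -> loewner_path U `[s, t] A2 Y2 ->
  s <= r <= t -> s <= r' <= t -> A1 r = A2 r -> Y1 r = Y2 r ->
  A1 r' = A2 r' /\ Y1 r' = Y2 r'.
Proof.
move=> st p1 p2 rst rst'.
have tt : `[s, t]%classic t by rewrite /= in_itv/= st lexx.
have [y1 _ _] := p1 t tt; have [y2 _ _] := p2 t tt.
pose a := Num.min (Y1 t) (Y2 t).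
have a0 : 0 < a by rewrite lt_min y1.
apply: (@truncated_path_unique U a _ _ _ _ s t r) => //; apply: loewner_path_truncated => // u;
  rewrite /= in_itv/= => ust; rewrite ge_min.
  by rewrite (loewner_path_im_ge ust p1).
by rewrite (loewner_path_im_ge ust p2) orbT.
Qed.

(** Backward in time the imaginary part increases, so the equation with the
    imaginary part truncated at its final value is the Loewner equation. *)
Lemma backward_path_exists U t0 x0 y0 : continuous U -> 0 < y0 ->
  exists A Y, [/\ A t0 = x0, Y t0 = y0 & loewner_path U `]-oo, t0] A Y].
Proof.
move=> cU y00; have [A [Y [At Yt p]]] := truncated_path_exists t0 x0 y0 cU y00.
exists A, Y; split => //; apply: (truncated_path_loewner y00); last first.
  exact: truncated_path_sub p.
move=> t; rewrite /= in_itv/= => tt0; rewrite -Yt.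
apply: (@der_in_nincr _ Y (fun x => vely (U x) (A x) (Num.max (Y x) y0))) => // x _.
  by have [//|_ d] := p x; apply: der_in_sub d.
have m0 : 0 < Num.max (Y x) y0 by rewrite lt_max y00 orbT.
by rewrite /vely oppr_le0 divr_ge0 ?(ltW (sqr_sum_gt0 _ m0))// mulr_ge0// ltW.
Qed.

Lemma loewner_path_im_sqr_le U A Y s t : s <= t -> loewner_path U `[s, t] A Y ->
  Y s ^+ 2 <= Y t ^+ 2 + 4 * (t - s).
Proof.
move=> st p; suff : Y s ^+ 2 + 4 * s <= Y t ^+ 2 + 4 * t by lra.
apply: (@der_in_ndecr _ (fun t => Y t ^+ 2 + 4 * t)
  (fun x => 2 * Y x * vely (U x) (A x) (Y x) + 4 * 1)) => // x xst;
  have [y0 _ d] := p x (mem_itvcc xst).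
  by apply: der_inD; [exact: der_in_sqr|exact: (der_inMl 4 (der_in_id _ _))].
have N0 := sqr_sum_gt0 (A x - U x) y0.
have -> : 2 * Y x * vely (U x) (A x) (Y x) + 4 * 1 =
  4 * (A x - U x) ^+ 2 / ((A x - U x) ^+ 2 + Y x ^+ 2).
  by rewrite /vely; field; rewrite gt_eqF.
by rewrite divr_ge0 ?(ltW N0)// mulr_ge0// sqr_ge0.
Qed.

End Paths.

(** * Estimates for a driving function of bounded variation *)

Section Estimates.
Variable R : realType.
Implicit Types (f g F U A Y phi : R -> R) (I J : set R) (a b c d e s t u x y m : R).

(** First-order expansion between two points on either side of [x]. *)
Lemma der_in_straddle f a b x d e : der_in `[a, b] f x d -> 0 < e ->
  exists2 k, 0 < k & forall u v, a <= u -> u <= x -> x <= v -> v <= b ->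
    x - u < k -> v - x < k -> `|f v - f u - d * (v - u)| <= e * (v - u).
Proof.
move=> /der_inP df e0; have [k k0 Hk] := df e e0; exists k => // u v au ux xv vb uk vk.
have hv := Hk v; have hu := Hk u.
have {}hv : `|f v - f x - d * (v - x)| <= e * (v - x).
  rewrite -[in leRHS](ger0_norm (_ : 0 <= v - x)); last lra.
  by apply: hv; [apply: mem_itvcc; apply/andP; split; lra|rewrite ger0_norm; lra].
have {}hu : `|f u - f x - d * (u - x)| <= e * (x - u).
  rewrite -[in leRHS](ger0_norm (_ : 0 <= x - u)) 1?[in leRHS]distrC; last lra.
  by apply: hu; [apply: mem_itvcc; apply/andP; split; lra|rewrite distrC ger0_norm; lra].
have -> : f v - f u - d * (v - u) = (f v - f x - d * (v - x)) - (f u - f x - d * (u - x)) by ring.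
by apply: le_trans (ler_normB _ _) _; lra.
Qed.

Lemma within_straddle f a b x e : {within `[a, b], continuous f} -> a <= x <= b -> 0 < e ->
  exists2 k, 0 < k & forall u, a <= u <= b -> `|u - x| < k -> `|f u - f x| < e.
Proof.
move=> /subspace_continuousP cf xab e0.
have /cvg_withinP/(_ e e0)[k k0 Hk] := cf x (mem_itvcc xab).
by exists k => // u uab; apply: Hk; exact: mem_itvcc.
Qed.

(** [phi] dominates the increments of [U]; the total variation of [U] on
    [[0, t]], as a function of [t], is such a function. *)
Definition dominates_increments phi U s t : Prop :=
  forall u v, s <= u -> u <= v -> v <= t -> `|U v - U u| <= phi v - phi u.

Section BoundedVariation.
Variables (U phi A Y : R -> R) (s t : R).
Hypotheses (st : s <= t) (cU : {within `[s, t], continuous U})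
  (phiU : dominates_increments phi U s t) (p : loewner_path U `[s, t] A Y).

Let X x : R := A x - U x.
Let k x : R := 2 / (X x ^+ 2 + Y x ^+ 2).

Let k_gt0 x : s <= x <= t -> 0 < k x.
Proof. by move=> /mem_itvcc/p[y0 _ _]; rewrite divr_gt0// sqr_sum_gt0. Qed.

Let dA x : s <= x <= t -> der_in `[s, t] A x (k x * X x).
Proof. by move=> /mem_itvcc/p[_ d _]; apply: der_in_eq d; rewrite /velx /k /X; ring. Qed.

Let X_straddle x e : s <= x <= t -> 0 < e ->
  exists2 r, 0 < r & forall u, s <= u -> u <= t -> `|u - x| < r -> `|X u - X x| <= e.
Proof.
move=> xst e0; have e2 : 0 < e / 2 by rewrite divr_gt0.
have [r1 r10 H1] := within_straddle cU xst e2.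
have /cvg_withinP/(_ _ e2)[r2 r20 H2] := der_in_cvg (dA xst).
exists (Num.min r1 r2); first by rewrite lt_min r10.
move=> u su ut; rewrite lt_min => /andP[/H1 h1 /H2 h2].
have ust : s <= u <= t by rewrite su ut.
have {}h1 := h1 ust; have {}h2 := h2 (mem_itvcc ust).
have -> : X u - X x = (A u - A x) - (U u - U x) by rewrite /X; ring.
by apply: le_trans (ler_normB _ _) _; lra.
Qed.

(** Backward in time the drift of [X] points to [0], so [|X|] grows no faster
    than [phi]. *)
Lemma loewner_path_re_le :
  `|A s - U s| <= `|A t - U t| + (phi t - phi s).
Proof.
suff : phi s + `|X s| <= phi t + `|X t| by rewrite /X; lra.
apply: (@le_of_straddle _ (fun x => phi x + `|X x|)) => // x e xst e0.
have kx := k_gt0 xst; pose e1 := e / 2 / (k x + 1).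
have e10 : 0 < e1 by rewrite !divr_gt0//; lra.
have ke1 : k x * e1 <= e / 2.
  by rewrite /e1 mulrCA ler_piMr ?divr_ge0 ?(ltW e0)// ler_pdivrMr; lra.
have [r1 r10 H1] := X_straddle xst e10.
have e2 : 0 < e / 2 by rewrite divr_gt0.
have [r2 r20 H2] := der_in_straddle (dA xst) e2.
exists (Num.min (Num.min r1 r2) (2^-1 / k x)).
  by rewrite !lt_min r10 r20 divr_gt0// invr_gt0.
move=> u v su ux xv vt; rewrite !lt_min => /andP[/andP[xu1 xu2] xu3] /andP[/andP[xv1 xv2] xv3].
have hA := H2 u v su ux xv vt xu2 xv2.
have hX : `|X v - X x| <= e1 by apply: H1; rewrite ?ger0_norm; lra.
have hU : `|U v - U u| <= phi v - phi u by apply: phiU => //; lra.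
pose h := v - u; have h0 : 0 <= h by rewrite /h; lra.
have kh : k x * h <= 1.
  have : h <= 1 / k x.
    by rewrite /h mul1r; move: xu3 xv3; rewrite mulrC; lra.
  by rewrite ler_pdivlMr// mulrC.
(* the drift acts on [X v] as a contraction, up to an error of order [e h] *)
have E : X u = (X v * (1 - k x * h) + k x * h * (X v - X x) - (A v - A u - k x * X x * h)) + (U v - U u).
  by rewrite /X /h; ring.
have hXu : `|X u| <= `|X v| * (1 - k x * h) + k x * h * e1 + e / 2 * h + `|U v - U u|.
  rewrite E; apply: le_trans (ler_normD _ _) _; rewrite lerD2r.
  apply: le_trans (ler_normB _ _) _; apply: lerD => //.
  apply: le_trans (ler_normD _ _) _.
  rewrite (normrM (X v)) (normrM (k x * h)) (normrM (k x)) (ger0_norm h0) (gtr0_norm kx).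
  rewrite (@ger0_norm _ (1 - k x * h)); last lra.
  by rewrite lerD2l ler_wpM2l// mulr_ge0// ltW.
have k1 : `|X v| * (1 - k x * h) <= `|X v|.
  by rewrite ler_piMr//; have := mulr_ge0 (ltW kx) h0; lra.
have k2 : k x * h * e1 <= e / 2 * h by rewrite mulrAC ler_wpM2r.
by rewrite -/h; lra.
Qed.

End BoundedVariation.

Lemma dominates_increments_sub phi U s t u v : s <= u -> v <= t ->
  dominates_increments phi U s t -> dominates_increments phi U u v.
Proof. by move=> su vt h a b ua ab bv; apply: h => //; lra. Qed.

(** In terms of [Z = X + i Y], the Loewner equation reads [d(Z^2) = 4 dt - 2 Z dU],
    whose real part gives [Y^2 - X^2] up to the integral of [X] against [U];
    that integral is controlled by the bound on [X] of [loewner_path_re_le]. *)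
Lemma loewner_path_im_sqr_ge U phi A Y s t : s <= t ->
  {within `[s, t], continuous U} -> dominates_increments phi U s t ->
  loewner_path U `[s, t] A Y ->
  Y t ^+ 2 + 4 * (t - s) + (A s - U s) ^+ 2 - (`|A t - U t| + (phi t - phi s)) ^+ 2 <= Y s ^+ 2.
Proof.
move=> st cU phiU p.
pose X x := A x - U x.
(* [psi] is the bound on [|X|] at earlier times *)
pose c := `|X t| + phi t; pose psi x := c - phi x.
pose k x := 2 / (X x ^+ 2 + Y x ^+ 2).
pose G x := X x ^+ 2 - psi x ^+ 2 - (Y x ^+ 2 + 4 * x).
suff : G s <= G t.
  have psit : psi t ^+ 2 = X t ^+ 2.
    by rewrite /psi /c addrK real_normK ?num_real.
  have psis : psi s = `|A t - U t| + (phi t - phi s) by rewrite /psi /c /X; ring.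
  by rewrite /G psit psis /X; lra.
have Xpsi x : s <= x <= t -> `|X x| <= psi x.
  move=> /andP[sx xt].
  have h := @loewner_path_re_le U phi A Y x t xt
    (continuous_subspaceW (itv_subset sx (lexx t)) cU)
    (dominates_increments_sub sx (lexx t) phiU)
    (loewner_path_sub (itv_subset sx (lexx t)) p).
  by rewrite /psi /c /X; lra.
apply: le_of_straddle => // x e xst e0.
have [y0 dA0 dY0] := p x (mem_itvcc xst).
have N0 := sqr_sum_gt0 (X x) y0.
have kx : 0 < k x by rewrite divr_gt0.
have dA : der_in `[s, t] A x (k x * X x).
  by apply: der_in_eq dA0; rewrite /velx /k /X; ring.
have dY : der_in `[s, t] (fun x => Y x ^+ 2 + 4 * x) x (2 * k x * X x ^+ 2).
  apply: der_in_eq (der_inD (der_in_sqr dY0) (der_inMl 4 (der_in_id _ _))).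
  by rewrite /vely /k -/(X x); field; rewrite gt_eqF.
pose q := `|X x|; have q0 : 0 <= q by exact: normr_ge0.
pose eta := Num.min 1 (e / (8 * (k x * q + 1))).
have kq : 0 <= k x * q by rewrite mulr_ge0// ltW.
have kq1 : 0 < 8 * (k x * q + 1) by lra.
have eta0 : 0 < eta by rewrite lt_min ltr01 divr_gt0.
have eta1 : eta <= 1 by rewrite ge_min lexx.
have etae : eta * (8 * (k x * q + 1)) <= e.
  by rewrite -ler_pdivlMr// ge_min lexx orbT.
pose e1 := e / (8 * (q + 1)).
have q1 : 0 < 8 * (q + 1) by lra.
have e10 : 0 < e1 by rewrite divr_gt0.
have e1e : e1 * (8 * (q + 1)) = e by rewrite /e1 divfK// gt_eqF.
have e2 : 0 < e / 2 by rewrite divr_gt0.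
have eta2 : 0 < eta / 2 by rewrite divr_gt0.
have [r1 r10 H1] := within_straddle cU xst eta2.
have /cvg_withinP/(_ _ eta2)[r2 r20 H2] := der_in_cvg dA.
have [r3 r30 H3] := der_in_straddle dA e10.
have [r4 r40 H4] := der_in_straddle dY e2.
exists (Num.min (Num.min r1 r2) (Num.min r3 r4)).
  by rewrite !lt_min r10 r20 r30 r40.
move=> u v su ux xv vt; rewrite !lt_min.
move=> /andP[/andP[u1 u2] /andP[u3 u4]] /andP[/andP[v1 v2] /andP[v3 v4]].
have hX w : s <= w <= t -> `|w - x| < r1 -> `|w - x| < r2 -> `|X w - X x| <= eta.
  move=> wst w1 w2; have h1 := H1 w wst w1; have h2 := H2 w (mem_itvcc wst) w2.
  have -> : X w - X x = (A w - A x) - (U w - U x) by rewrite /X; ring.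
  by apply: le_trans (ler_normB _ _) _; move: h1 h2; clear; lra.
have ust : s <= u <= t by rewrite su (le_trans ux (le_trans xv vt)).
have vst : s <= v <= t by rewrite vt (le_trans su (le_trans ux xv)).
have hXu : `|X u - X x| <= eta by apply: hX => //; rewrite distrC ger0_norm ?subr_ge0.
have hXv : `|X v - X x| <= eta by apply: hX => //; rewrite ger0_norm ?subr_ge0.
have hA := H3 u v su ux xv vt u3 v3.
have hY := H4 u v su ux xv vt u4 v4.
have uv : u <= v by exact: le_trans xv.
have hU := phiU u v su uv vt.
have pu := Xpsi u ust; have pv := Xpsi v vst.
set h := v - u in hA hY *; have h0 : 0 <= h by rewrite /h subr_ge0.
(* replacing the increment of [psi ^ 2] by that of [U] times [X u + X v] *)
have step1 : X u ^+ 2 - psi u ^+ 2 - (X v ^+ 2 - psi v ^+ 2) <= - ((X v + X u) * (A v - A u)).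
  have E : X u ^+ 2 - X v ^+ 2 = - ((X v + X u) * (A v - A u)) + (X v + X u) * (U v - U u).
    by rewrite /X; ring.
  have E2 : psi v ^+ 2 - psi u ^+ 2 = - ((psi v + psi u) * (phi v - phi u)) by rewrite /psi; ring.
  suff : (X v + X u) * (U v - U u) <= (psi v + psi u) * (phi v - phi u) by move: E E2; clear; lra.
  apply: le_trans (ler_norm _) _; rewrite normrM; apply: ler_pM => //.
  by apply: le_trans (ler_normD _ _) _; exact: lerD.
have step2 : 2 * k x * X x ^+ 2 * h - (X v + X u) * (A v - A u) <= e / 2 * h.
  have -> : 2 * k x * X x ^+ 2 * h - (X v + X u) * (A v - A u) =
    - ((X v + X u) * (A v - A u - k x * X x * h)) -
      ((X v - X x) + (X u - X x)) * (k x * X x * h) by ring.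
  apply: le_trans (ler_norm _) _; apply: le_trans (ler_normB _ _) _.
  rewrite normrN (normrM (X v + X u)) (normrM (_ + _) (k x * X x * h)).
  rewrite (normrM (k x * X x)) (normrM (k x)) (ger0_norm h0) (gtr0_norm kx) -/q.
  have n1 : `|X v + X u| <= 2 * (q + 1).
    have -> : X v + X u = ((X v - X x) + (X u - X x)) + 2 * X x by ring.
    apply: le_trans (ler_normD _ _) _; apply: le_trans (lerD (ler_normD _ _) (lexx _)) _.
    by rewrite normrM ger0_norm// -/q; move: hXu hXv eta1; clear; lra.
  have n2 : `|(X v - X x) + (X u - X x)| <= 2 * eta.
    by apply: le_trans (ler_normD _ _) _; move: hXu hXv; clear; lra.
  have m1 : `|X v + X u| * `|A v - A u - k x * X x * h| <= 2 * (q + 1) * (e1 * h).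
    by apply: ler_pM.
  have m2 : `|(X v - X x) + (X u - X x)| * (k x * q * h) <= 2 * eta * (k x * q * h).
    by apply: ler_wpM2r => //; rewrite mulr_ge0.
  have m3 : 2 * (q + 1) * (e1 * h) = e / 4 * h.
    by rewrite -e1e; field.
  have m4 : 2 * eta * (k x * q * h) <= e / 4 * h.
    have : 2 * eta * (k x * q) <= e / 4 by move: etae eta0; clear; lra.
    by move=> m; rewrite mulrA; apply: ler_wpM2r.
  by move: m1 m2 m3 m4; clear; lra.
move: hY; rewrite ler_norml => /andP[hY1 hY2].
by move: hY2 step1 step2; clear; rewrite /G /=; lra.
Qed.

(** [Q = |Z1 - Z2|^2 / (Y1 Y2)] is a function of the hyperbolic distance
    between the two paths; it increases with time, at a definite rate away
    from the boundary. *)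
Lemma der_in_hyperbolic U A1 Y1 A2 Y2 I t : I t ->
  loewner_path U I A1 Y1 -> loewner_path U I A2 Y2 ->
  let Q t := ((A1 t - A2 t) ^+ 2 + (Y1 t - Y2 t) ^+ 2) / (Y1 t * Y2 t) in
  der_in I Q t (Q t * (2 * ((A1 t - A2 t) ^+ 2 + (Y1 t + Y2 t) ^+ 2) /
    (((A1 t - U t) ^+ 2 + Y1 t ^+ 2) * ((A2 t - U t) ^+ 2 + Y2 t ^+ 2)))).
Proof.
move=> It p1 p2 Q.
have [y1 dA1 dY1] := p1 t It; have [y2 dA2 dY2] := p2 t It.
have yy : Y1 t * Y2 t != 0 by rewrite gt_eqF// mulr_gt0.
apply: der_in_eq (der_inM (der_inD (der_in_sqr (der_inB dA1 dA2))
  (der_in_sqr (der_inB dY1 dY2))) (@der_inV R I (fun t => Y1 t * Y2 t) t _ yy (der_inM dY1 dY2))).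
have N1 := sqr_sum_gt0 (A1 t - U t) y1; have N2 := sqr_sum_gt0 (A2 t - U t) y2.
rewrite /Q /velx /vely; field.
by rewrite !gt_eqF.
Qed.

End Estimates.

(** * Contraction near the singularity *)

Section Tip.
Variable R : realType.
Implicit Types (f g F A Y : R -> R) (I J : set R) (a b d e s t u x y m : R).

Lemma der_inX I f x d n : der_in I f x d ->
  der_in I (fun t => f t ^+ n.+1) x (n.+1%:R * f x ^+ n * d).
Proof.
move=> df; elim: n => [|n IH].
  rewrite expr0 !mul1r; under eq_fun do rewrite expr1; exact: df.
rewrite (_ : (fun t => _) = fun t => f t * f t ^+ n.+1); last first.
  by apply/funext => t; rewrite exprS.
by apply: der_in_eq (der_inM df IH); rewrite -[in RHS]natr1 !exprS; ring.
Qed.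

Implicit Types (U phi : R -> R).

(** [phi] dominates the increments of [U] on [[0, t0]], with the square root
    behaviour below the critical constant [2] at the left of [t0]. *)
Definition subcritical_at phi U t0 : Prop :=
  [/\ continuous U, dominates_increments phi U 0 t0 &
    exists c s1, [/\ 0 <= c < 2, 0 < s1 <= t0 &
      forall s, 0 < s -> s <= s1 -> phi t0 - phi (t0 - s) <= c * Num.sqrt s]].

(** A path whose final time is within [d] of [t0] and whose final value is
    within [d], in both coordinates, of the singularity. *)
Definition near_tip U t0 d t A Y : Prop :=
  [/\ t0 - d <= t <= t0, loewner_path U `[0, t] A Y,
      `|A t - U t| <= d & Y t <= d].

Lemma dominates_increments_ndecr U phi t0 u v : dominates_increments phi U 0 t0 ->
  0 <= u -> u <= v -> v <= t0 -> phi u <= phi v.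
Proof. by move=> phiU u0 uv vt; rewrite -subr_ge0; apply: le_trans (phiU _ _ u0 uv vt). Qed.

(** All paths ending close enough to the singularity obey the scaling of the
    square root at all times whose distance to [t0] lies between [sg] and [s1]. *)
Lemma near_tip_scaling U phi t0 : subcritical_at phi U t0 ->
  exists2 kp, 0 < kp & exists2 s1, 0 < s1 <= t0 & forall sg, 0 < sg -> sg <= s1 ->
    exists2 d, 0 < d < sg & forall t A Y, near_tip U t0 d t A Y ->
      forall s, sg <= s -> s <= s1 -> [/\ t0 - s <= t,
        (A (t0 - s) - U (t0 - s)) ^+ 2 <= 4 * s,
        kp * s <= Y (t0 - s) ^+ 2 & Y (t0 - s) ^+ 2 <= 5 * s].
Proof.
move=> [cU phiU [c [s1 [/andP[c0 c2] /andP[s10 s1t] phis]]]].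
(* the room between [c] and [c'] absorbs the final value of [X] *)
pose c' := (c + 2) / 2.
have c'0 : 0 <= c' by rewrite /c'; move: c0; clear; lra.
have c'2 : c' < 2 by rewrite /c'; move: c2; clear; lra.
have cc' : 0 < c' - c by rewrite /c'; move: c2; clear; lra.
have c'4 : 0 < 4 - c' ^+ 2 by move: c'0 c'2; clear; nra.
exists ((4 - c' ^+ 2) / 2); first by rewrite divr_gt0.
exists s1; first by rewrite s10.
move=> sg sg0 sgs1.
have rsg : 0 < Num.sqrt sg by rewrite sqrtr_gt0.
pose d := Num.min (Num.min (sg / 2) (Num.sqrt sg))
  (Num.min ((c' - c) * Num.sqrt sg) ((4 - c' ^+ 2) * sg / 8)).
have d0 : 0 < d by rewrite !lt_min !divr_gt0 ?rsg ?mulr_gt0.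
have d1 : d <= sg / 2 by rewrite !ge_min lexx.
have d2 : d <= Num.sqrt sg by rewrite !ge_min lexx !orbT.
have d3 : d <= (c' - c) * Num.sqrt sg by rewrite !ge_min lexx !orbT.
have d4 : d <= (4 - c' ^+ 2) * sg / 8 by rewrite !ge_min lexx !orbT.
have dd : d ^+ 2 <= sg by rewrite -[leRHS](sqr_sqrtr (ltW sg0)) ler_sqr ?nnegrE// ltW.
clearbody d.
exists d; first by rewrite d0/=; move: sg0 d1; clear; lra.
move=> t A Y [/andP[dt tt] p Xd Yd] s sgs ss1.
have s0 : 0 < s by exact: lt_le_trans sgs.
have u0 : 0 <= t0 - s by move: ss1 s1t; clear; lra.
have ut : t0 - s <= t by move: dt d1 sgs sg0; clear; lra.
set u := t0 - s in u0 ut *.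
have pu := loewner_path_sub (itv_subset u0 (lexx t)) p.
have cUu : {within `[u, t], continuous U} by exact: continuous_subspaceT.
have phiu := dominates_increments_sub u0 tt phiU.
have rs : 0 <= Num.sqrt s by exact: sqrtr_ge0.
have rss : Num.sqrt sg <= Num.sqrt s by rewrite ler_wsqrtr.
have sq : Num.sqrt s ^+ 2 = s by rewrite sqr_sqrtr// ltW.
have t00 : 0 <= t by exact: le_trans ut.
have hphi : phi t - phi u <= c * Num.sqrt s.
  by have := phis _ s0 ss1; have := dominates_increments_ndecr phiU t00 tt (lexx _); rewrite -/u; clear; lra.
have X1 : `|A t - U t| + (phi t - phi u) <= c' * Num.sqrt s.
  by have := ler_wpM2l (ltW cc') rss; move: d3 Xd hphi; clear; lra.
have X2 := loewner_path_re_le ut cUu phiu pu.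
have X3 : (`|A t - U t| + (phi t - phi u)) ^+ 2 <= c' ^+ 2 * s.
  rewrite -sq -exprMn ler_sqr// nnegrE; last exact: (mulr_ge0 c'0 rs).
  by apply: le_trans X2; exact: normr_ge0.
split=> //.
- have X4 : (A u - U u) ^+ 2 <= (`|A t - U t| + (phi t - phi u)) ^+ 2.
    by rewrite -[leLHS]real_normK ?num_real// ler_sqr ?nnegrE//; exact: le_trans X2.
  by have := mulr_ge0 (ltW c'4) (ltW s0); move: X3 X4; clear; lra.
- have h := loewner_path_im_sqr_ge ut cUu phiu pu.
  have h1 := sqr_ge0 (Y t); have h2 := sqr_ge0 (A u - U u).
  have h3 : (4 - c' ^+ 2) * sg <= (4 - c' ^+ 2) * s by rewrite ler_pM2l.
  have E : 4 * (t - u) = 4 * s + 4 * (t - t0) by rewrite /u; ring.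
  by move: E h h1 h2 h3 X3 dt d4; clear; lra.
- have h := loewner_path_im_sqr_le ut pu.
  have [y0 _ _] : [/\ 0 < Y t, _ & _] := p t (mem_itvcc (introT andP (conj t00 (lexx t)))).
  have h1 : Y t ^+ 2 <= d ^+ 2 by rewrite ler_sqr ?nnegrE ?(ltW y0) ?(ltW d0).
  by move: h h1 dd sgs tt; rewrite /u; clear; lra.
Qed.

(** At a given time before [t0], the imaginary part is bounded below. *)
Lemma near_tip_im_lower U phi t0 u : subcritical_at phi U t0 ->
  0 <= u -> u < t0 -> exists2 d, 0 < d &
  exists2 y, 0 < y & forall t A Y, near_tip U t0 d t A Y -> u <= t /\ y <= Y u.
Proof.
move=> sub u0 ut; have [kp kp0 [s1 /andP[s10 s1t] H]] := near_tip_scaling sub.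
pose s := Num.min s1 (t0 - u).
have s0 : 0 < s by rewrite lt_min s10 subr_gt0.
have ss1 : s <= s1 by rewrite ge_min lexx.
have su : s <= t0 - u by rewrite ge_min lexx orbT.
have [d /andP[d0 ds] Hd] := H s s0 ss1; exists d => //.
exists (Num.sqrt (kp * s)); first by rewrite sqrtr_gt0 mulr_gt0.
move=> t A Y nt; have [h1 h2 h3 h4] := Hd t A Y nt s (lexx s) ss1.
have us : u <= t0 - s by move: su; clear; lra.
split; first exact: le_trans h1.
have [_ p _ _] := nt.
have pu := loewner_path_sub (itv_subset u0 (lexx t)) p.
have ss : t0 - s \in `[u, t] by rewrite in_itv/= us.
have [y0 _ _] := pu _ ss.
apply: (@le_trans _ _ (Y (t0 - s))).
  by rewrite -[leRHS]ger0_norm ?(ltW y0)// -sqrtr_sqr ler_wsqrtr.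
apply: (@loewner_path_im_nincr _ U A Y) => //.
exact: loewner_path_sub (itv_subset (lexx u) h1) pu.
Qed.

(** The hyperbolic distance between paths ending near the singularity at a time
    near [t0] has decayed at any earlier time [u]. The decay is a power law: as
    [Q] increases at a rate at least a multiple of [Q / (t0 - x)], some power of
    [Q] times [t0 - x] is nondecreasing in the time [x]. *)
Lemma near_tip_contraction U phi t0 u e : subcritical_at phi U t0 ->
  0 <= u -> u < t0 -> 0 < e -> exists2 d, 0 < d &
  forall t A1 Y1 t' A2 Y2, near_tip U t0 d t A1 Y1 -> near_tip U t0 d t' A2 Y2 ->
    (A1 u - A2 u) ^+ 2 + (Y1 u - Y2 u) ^+ 2 <= e.
Proof.
move=> sub u0 ut e0; have [kp kp0 [s1 /andP[s10 s1t] H]] := near_tip_scaling sub.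
pose s2 := Num.min s1 (t0 - u).
have s20 : 0 < s2 by rewrite lt_min s10 subr_gt0.
have s2s1 : s2 <= s1 by rewrite ge_min lexx.
have s2u : s2 <= t0 - u by rewrite ge_min lexx orbT.
have t00 : 0 < t0 by exact: lt_le_trans s1t.
(* [n] is such that the [n.+1]-th power of [Q] decays at least like [1 / s] *)
have [n Hn] : exists n : nat, 1 <= n.+1%:R * (8 * kp / 81).
  exists (Num.bound (81 / (8 * kp))).
  rewrite -ler_pdivrMr; last by rewrite divr_gt0// mulr_gt0.
  rewrite div1r invf_div; apply: ltW; apply: lt_le_trans (archi_boundP _) _.
    by rewrite divr_ge0// mulr_ge0// ltW.
  by rewrite ler_nat.
pose C := 21 / kp; have C0 : 0 < C by rewrite divr_gt0.
pose e' := e / (5 * t0); have e'0 : 0 < e' by rewrite divr_gt0// mulr_gt0.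
pose sg := Num.min s2 (s2 * (e' / C) ^+ n.+1).
have sg0 : 0 < sg by rewrite lt_min s20 mulr_gt0// exprn_gt0// divr_gt0.
have sgs2 : sg <= s2 by rewrite ge_min lexx.
have sge : C ^+ n.+1 * sg <= s2 * e' ^+ n.+1.
  rewrite mulrC -ler_pdivlMr ?exprn_gt0// -mulrA -expr_div_n.
  by rewrite ge_min lexx orbT.
have [d /andP[d0 dsg] Hd] := H sg sg0 (le_trans sgs2 s2s1).
exists d => // t A1 Y1 t' A2 Y2 nt nt'.
have B1 := Hd _ _ _ nt; have B2 := Hd _ _ _ nt'.
have [_ p1 _ yd1] := nt; have [_ p2 _ yd2] := nt'.
pose Q x := ((A1 x - A2 x) ^+ 2 + (Y1 x - Y2 x) ^+ 2) / (Y1 x * Y2 x).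
pose w x := 2 * ((A1 x - A2 x) ^+ 2 + (Y1 x + Y2 x) ^+ 2) /
    (((A1 x - U x) ^+ 2 + Y1 x ^+ 2) * ((A2 x - U x) ^+ 2 + Y2 x ^+ 2)).
have [tsg _ _ _] := B1 sg (lexx _) (le_trans sgs2 s2s1).
have [tsg' _ _ _] := B2 sg (lexx _) (le_trans sgs2 s2s1).
set r := t0 - sg in tsg tsg'.
have ur : u <= t0 - s2 by move: s2u; clear; lra.
have sr : t0 - s2 <= r by rewrite /r; move: sgs2; clear; lra.
have {}p1 : loewner_path U `[u, r] A1 Y1 by exact: loewner_path_sub (itv_subset u0 tsg) p1.
have {}p2 : loewner_path U `[u, r] A2 Y2 by exact: loewner_path_sub (itv_subset u0 tsg') p2.
have yy x : u <= x <= r -> 0 < Y1 x * Y2 x.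
  by move=> /mem_itvcc xx; have [? _ _] := p1 x xx; have [? _ _] := p2 x xx; rewrite mulr_gt0.
have Q0 x : u <= x <= r -> 0 <= Q x.
  by move=> xx; rewrite divr_ge0 ?(ltW (yy x xx))// addr_ge0 ?sqr_ge0.
have dQ x : u <= x <= r -> der_in `[u, r] Q x (Q x * w x).
  by move=> xx; exact: (der_in_hyperbolic (mem_itvcc xx) p1 p2).
have N0 x : u <= x <= r -> 0 < ((A1 x - U x) ^+ 2 + Y1 x ^+ 2) * ((A2 x - U x) ^+ 2 + Y2 x ^+ 2).
  by move=> /mem_itvcc xx; have [? _ _] := p1 x xx; have [? _ _] := p2 x xx; rewrite mulr_gt0// sqr_sum_gt0.
have w0 x : u <= x <= r -> 0 <= w x.
  by move=> xx; rewrite divr_ge0 ?(ltW (N0 x xx))// mulr_ge0// addr_ge0 ?sqr_ge0.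
have YY x : t0 - s2 <= x <= r -> kp * (t0 - x) <= Y1 x * Y2 x /\
    ((A1 x - U x) ^+ 2 + Y1 x ^+ 2) * ((A2 x - U x) ^+ 2 + Y2 x ^+ 2) <= 81 * (t0 - x) ^+ 2.
  move=> /andP[sx xr].
  have x1 : sg <= t0 - x by move: xr; rewrite /r; clear; lra.
  have x2 : t0 - x <= s1 by move: sx s2s1; clear; lra.
  have [_ b1 b2 b3] := B1 _ x1 x2; have [_ b4 b5 b6] := B2 _ x1 x2.
  have xE : t0 - (t0 - x) = x by ring.
  rewrite !xE in b1 b2 b3 b4 b5 b6.
  have s0 : 0 < t0 - x by exact: lt_le_trans x1.
  have xx : u <= x <= r by rewrite xr (le_trans ur).
  have y0 := yy x xx.
  split.
    rewrite -ler_sqr ?nnegrE ?(ltW y0) ?mulr_ge0 ?(ltW s0) ?(ltW kp0)//.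
    by rewrite exprMn [leRHS]exprMn -exprMn expr2; apply: ler_pM => //; rewrite mulr_ge0// ltW.
  have -> : 81 * (t0 - x) ^+ 2 = (9 * (t0 - x)) * (9 * (t0 - x)) by ring.
  by apply: ler_pM; rewrite ?addr_ge0 ?sqr_ge0//; move: b1 b3 b4 b6; clear; lra.
have Qr : Q r <= C.
  have rr : t0 - s2 <= r <= r by rewrite sr lexx.
  have [y1 _] := YY r rr.
  have [_ b1 b2 b3] := B1 _ (lexx _) (le_trans sgs2 s2s1).
  have [_ b4 b5 b6] := B2 _ (lexx _) (le_trans sgs2 s2s1).
  rewrite -/r in b1 b2 b3 b4 b5 b6.
  have rE : t0 - r = sg by rewrite /r; ring.
  rewrite rE in y1.
  have r0 : u <= r <= r by rewrite lexx (le_trans ur sr).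
  rewrite ler_pdivrMr ?yy//.
  have h1 : C * (kp * sg) <= C * (Y1 r * Y2 r) by rewrite ler_pM2l.
  have h2 : C * (kp * sg) = 21 * sg by rewrite /C mulrA divfK// gt_eqF.
  have h3 : (A1 r - A2 r) ^+ 2 <= 2 * (A1 r - U r) ^+ 2 + 2 * (A2 r - U r) ^+ 2.
    by have := sqr_ge0 ((A1 r - U r) + (A2 r - U r)); clear; nra.
  have h4 : (Y1 r - Y2 r) ^+ 2 <= Y1 r ^+ 2 + Y2 r ^+ 2 by have := ltW (yy r r0); clear; nra.
  have h5 : (Y1 r - Y2 r) ^+ 2 <= 5 * sg.
    have /mem_itvcc r1 := r0.
    have [z1 _ _] := p1 r r1; have [z2 _ _] := p2 r r1.
    have [zz|zz] := leP (Y1 r) (Y2 r).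
      by apply: le_trans b6; move: z1 z2 zz; clear; nra.
    by apply: le_trans b3; move: z1 z2 zz; clear; nra.
  by move: h1 h2 h3 h5 b1 b4; clear; lra.
(* the decay between the distances [s2] and [sg] from [t0] *)
have mono : Q (t0 - s2) ^+ n.+1 * (t0 - (t0 - s2)) <= Q r ^+ n.+1 * (t0 - r).
  apply: (@der_in_ndecr _ (fun x => Q x ^+ n.+1 * (t0 - x))
    (fun x => n.+1%:R * Q x ^+ n * (Q x * w x) * (t0 - x) + Q x ^+ n.+1 * (0 - 1))) => // x xx.
    apply: der_inM; last exact: (der_inB (der_in_cst _ t0 _) (der_in_id _ _)).
    apply: der_inX; apply: (der_in_sub (itv_subset ur (lexx r))); apply: dQ.
    by case/andP: xx => xx ->; rewrite (le_trans ur xx).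
  have xx' : u <= x <= r by case/andP: xx => xx ->; rewrite (le_trans ur xx).
  have -> : n.+1%:R * Q x ^+ n * (Q x * w x) * (t0 - x) + Q x ^+ n.+1 * (0 - 1) =
     Q x ^+ n.+1 * (n.+1%:R * (w x * (t0 - x)) - 1) by rewrite exprS; ring.
  rewrite mulr_ge0 ?exprn_ge0 ?Q0// subr_ge0; apply: le_trans Hn _.
  rewrite ler_pM2l ?ltr0n//.
  have [b1 b2] := YY x xx.
  have sx : 0 < t0 - x by move: sg0; case/andP: xx; rewrite /r; clear; lra.
  rewrite /w [leRHS]mulrAC ler_pdivlMr ?N0//.
  have k1 := mulr_gt0 kp0 sx.
  have h1 : 8 * kp / 81 * (((A1 x - U x) ^+ 2 + Y1 x ^+ 2) * ((A2 x - U x) ^+ 2 + Y2 x ^+ 2))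
     <= 8 * kp / 81 * (81 * (t0 - x) ^+ 2) by rewrite ler_wpM2l// divr_ge0// mulr_ge0// ltW.
  apply: le_trans h1 _.
  have h2 : 4 * (Y1 x * Y2 x) <= (Y1 x + Y2 x) ^+ 2 by have := sqr_ge0 (Y1 x - Y2 x); clear; nra.
  have h3 : 8 * (kp * (t0 - x)) <= 2 * ((A1 x - A2 x) ^+ 2 + (Y1 x + Y2 x) ^+ 2).
    by have := sqr_ge0 (A1 x - A2 x); move: h2 b1; clear; lra.
  have -> : 8 * kp / 81 * (81 * (t0 - x) ^+ 2) = 8 * (kp * (t0 - x)) * (t0 - x) by field.
  by rewrite ler_pM2r.
have Qs2 : Q (t0 - s2) <= e'.
  have ss : u <= t0 - s2 <= r by rewrite ur sr.
  rewrite -(@ler_pXn2r _ n.+1)// ?nnegrE ?Q0 ?(ltW e'0)//.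
  rewrite -(ler_pM2l s20); apply: le_trans sge.
  have E1 : t0 - (t0 - s2) = s2 by ring.
  have E2 : t0 - r = sg by rewrite /r; ring.
  rewrite E1 E2 in mono; rewrite mulrC; apply: le_trans mono _.
  rewrite ler_pM2r// ler_pXn2r// ?nnegrE ?(ltW C0)//; apply: Q0.
  by rewrite lexx (le_trans ur sr).
have uu : u <= u <= r by rewrite lexx (le_trans ur sr).
have Qu : Q u <= e'.
  apply: le_trans Qs2.
  apply: (@der_in_ndecr _ Q (fun x => Q x * w x)) => // x /andP[ux xs].
    apply: (der_in_sub (itv_subset (lexx u) sr)); apply: dQ.
    by rewrite ux (le_trans xs sr).
  by rewrite mulr_ge0 ?Q0 ?w0// ux (le_trans xs sr).
have ybound A Y : loewner_path U `[u, r] A Y -> Y r ^+ 2 <= 5 * sg -> Y u ^+ 2 <= 5 * t0.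
  move=> p h1; have h := loewner_path_im_sqr_le (le_trans ur sr) p.
  by move: h h1 u0 (le_trans sgs2 s2s1) s1t; rewrite /r; clear; lra.
have [_ _ _ b3] := B1 _ (lexx _) (le_trans sgs2 s2s1).
have [_ _ _ b6] := B2 _ (lexx _) (le_trans sgs2 s2s1).
have yu1 := ybound _ _ p1 b3; have yu2 := ybound _ _ p2 b6.
have yyu : Y1 u * Y2 u <= 5 * t0.
  by have := sqr_ge0 (Y1 u - Y2 u); move: yu1 yu2; clear; nra.
have -> : (A1 u - A2 u) ^+ 2 + (Y1 u - Y2 u) ^+ 2 = Q u * (Y1 u * Y2 u).
  by rewrite /Q divfK// gt_eqF// yy.
have -> : e = e' * (5 * t0) by rewrite /e' divfK// gt_eqF// mulr_gt0.
by apply: ler_pM => //; [exact: Q0|rewrite ltW// yy].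
Qed.

End Tip.

(** * The path ending at the singularity *)

Section Trace.
Variable R : realType.
Implicit Types (f g F A Y : R -> R) (I J : set R) (a b d e s t u x y m : R).
Implicit Types (U phi : R -> R).

Lemma loewner_path_ext U I A Y A' Y' :
  (forall t, I t -> A' t = A t /\ Y' t = Y t) -> loewner_path U I A Y -> loewner_path U I A' Y'.
Proof.
move=> E p t It; have [EA EY] := E t It; have [y0 dA dY] := p t It.
rewrite EA EY; split => //.
  by apply: der_in_ext dA => // y /E[].
by apply: der_in_ext dY => // y /E[].
Qed.

(** The Loewner flow, run backward, contracts the hyperbolic metric. *)
Lemma hyperbolic_le U A1 Y1 A2 Y2 u b : u <= b ->
  loewner_path U `[u, b] A1 Y1 -> loewner_path U `[u, b] A2 Y2 ->
  ((A1 u - A2 u) ^+ 2 + (Y1 u - Y2 u) ^+ 2) / (Y1 u * Y2 u) <=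
  ((A1 b - A2 b) ^+ 2 + (Y1 b - Y2 b) ^+ 2) / (Y1 b * Y2 b).
Proof.
move=> ub p1 p2.
apply: (@der_in_ndecr _ (fun t => ((A1 t - A2 t) ^+ 2 + (Y1 t - Y2 t) ^+ 2) / (Y1 t * Y2 t))
  _ u b ub).
  by move=> x /mem_itvcc xub; exact: (der_in_hyperbolic xub p1 p2).
move=> x /mem_itvcc xub; have [y1 _ _] := p1 x xub; have [y2 _ _] := p2 x xub.
have n1 := sqr_sum_gt0 (A1 x - U x) y1; have n2 := sqr_sum_gt0 (A2 x - U x) y2.
by rewrite mulr_ge0// divr_ge0 ?(ltW (mulr_gt0 y1 y2)) ?(ltW (mulr_gt0 n1 n2))//
  ?mulr_ge0// addr_ge0 ?sqr_ge0.
Qed.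

(** Backward in time, paths depend continuously on their final value. *)
Lemma loewner_path_continuous U A Y u b e : u <= b -> 0 < e ->
  loewner_path U `[u, b] A Y -> exists2 d, 0 < d & forall A' Y',
    loewner_path U `[u, b] A' Y' -> `|A' b - A b| <= d -> `|Y' b - Y b| <= d ->
    (A' u - A u) ^+ 2 + (Y' u - Y u) ^+ 2 <= e.
Proof.
move=> ub e0 p.
have bb : u <= b <= b by rewrite ub lexx.
have uu : u <= u <= b by rewrite ub lexx.
have [y0 _ _] := p b (mem_itvcc bb); set y := Y b in y0 *.
pose M := 4 * y ^+ 2 + 4 * (b - u).
have M0 : 0 < M by have := exprn_gt0 2 y0; rewrite /M; lra.
pose d := Num.min (Num.min 1 (y / 2)) (e * y ^+ 2 / (4 * M)).
have d0 : 0 < d.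
  by rewrite !lt_min ltr01 !divr_gt0 ?mulr_gt0 ?exprn_gt0.
have d1 : d <= 1 by rewrite !ge_min lexx.
have dy : d <= y / 2 by rewrite !ge_min lexx orbT.
have de : d * (4 * M) <= e * y ^+ 2.
  by rewrite -ler_pdivlMr ?mulr_gt0// ge_min lexx orbT.
clearbody d; exists d => // A' Y' p' Ad Yd.
have [y0' _ _] := p' b (mem_itvcc bb).
have [v0 _ _] := p u (mem_itvcc uu); have [v0' _ _] := p' u (mem_itvcc uu).
have /andP[Yd1 Yd2] : (- d <= Y' b - y) && (Y' b - y <= d) by rewrite -ler_norml.
have h := hyperbolic_le ub p' p.
have hY := loewner_path_im_sqr_le ub p; have hY' := loewner_path_im_sqr_le ub p'.
rewrite -/y in h hY.
rewrite ler_pdivrMr ?mulr_gt0// in h; apply: le_trans h _.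
have yy : y ^+ 2 / 2 <= Y' b * y by move: Yd1 dy y0; clear; nra.
have hM : Y' u * Y u <= M.
  have h1 : Y u ^+ 2 <= M by rewrite /M; have := sqr_ge0 y; move: hY ub; clear; lra.
  have h2 : Y' b ^+ 2 <= 4 * y ^+ 2 by move: Yd2 dy y0 y0'; clear; nra.
  have h3 : Y' u ^+ 2 <= M by rewrite /M; move: hY' h2; clear; lra.
  by have := sqr_ge0 (Y' u - Y u); move: h1 h3; clear; nra.
have hP : (A' b - A b) ^+ 2 + (Y' b - y) ^+ 2 <= 2 * d.
  have h1 : `|A' b - A b| ^+ 2 <= d.
    by have := normr_ge0 (A' b - A b); move: Ad d1 d0; clear; nra.
  have h2 : `|Y' b - y| ^+ 2 <= d.
    by have := normr_ge0 (Y' b - y); move: Yd d1 d0; clear; nra.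
  by rewrite !real_normK ?num_real// in h1 h2; move: h1 h2; clear; lra.
rewrite mulrAC ler_pdivrMr ?mulr_gt0//.
apply: le_trans (_ : 2 * d * M <= _).
  by apply: ler_pM => //; [rewrite addr_ge0 ?sqr_ge0|rewrite ltW// mulr_gt0].
have : e * (y ^+ 2 / 2) <= e * (Y' b * y) by rewrite ler_pM2l.
by move: de; clear; lra.
Qed.

(** Cauchy criterion for a limit at the right of [0]. *)
Lemma right_limit_exists f :
  (forall e, 0 < e -> exists2 d, 0 < d & forall y y', 0 < y -> y <= d ->
     0 < y' -> y' <= d -> `|f y - f y'| <= e) ->
  exists l, forall e, 0 < e -> exists2 d, 0 < d & forall y, 0 < y -> y <= d -> `|f y - l| <= e.
Proof.
move=> H.
have : cvg (f @ 0^'+).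
  apply: cauchy_cvg; apply: cauchy_exP => e e0; have e2 : 0 < e / 2 by rewrite divr_gt0.
  have [d d0 Hd] := H _ e2; exists (f d); exists d => //= y.
  rewrite /ball/= sub0r normrN => yd y0; apply: le_lt_trans (Hd _ _ d0 (lexx d) y0 _) _.
    by rewrite gtr0_norm in yd => //; exact: ltW.
  by move: e0; clear; lra.
move=> /cvg_ex[l /cvgrPdist_le Hl]; exists l => e e0.
have [d /= d0 Hd] := Hl e e0; exists (d / 2); first by rewrite divr_gt0.
move=> y y0 yd; rewrite distrC; apply: Hd => //.
by rewrite /ball/= sub0r normrN gtr0_norm//; move: y0 yd d0; clear; lra.
Qed.

Lemma sqr_le_norm x e : 0 <= e -> `|x| <= e -> e <= 1 -> x ^+ 2 <= e.
Proof.
move=> e0 xe e1; rewrite -[x ^+ 2]real_normK ?num_real//.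
by have := normr_ge0 x; nra.
Qed.

Lemma norm_le_sqr x y e : 0 < e -> x ^+ 2 + y ^+ 2 <= e ^+ 2 -> `|x| <= e /\ `|y| <= e.
Proof.
move=> e0 h; have := sqr_ge0 x; have := sqr_ge0 y => h1 h2.
split; rewrite -ler_sqr ?nnegrE ?normr_ge0 ?(ltW e0)// real_normK ?num_real//; lra.
Qed.

Lemma sqr_sumB_le (x1 y1 x2 y2 x3 y3 : R) :
  (x1 - x3) ^+ 2 + (y1 - y3) ^+ 2 <=
  2 * ((x1 - x2) ^+ 2 + (y1 - y2) ^+ 2) + 2 * ((x2 - x3) ^+ 2 + (y2 - y3) ^+ 2).
Proof.
by have := sqr_ge0 ((x1 - x2) - (x2 - x3)); have := sqr_ge0 ((y1 - y2) - (y2 - y3)); nra.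
Qed.

(** The path that ends at the singularity at time [t0]: all paths that come
    close to the singularity near [t0] converge to it. *)
Lemma tip_path_exists U phi t0 : subcritical_at phi U t0 ->
  exists A Y, [/\ forall b, b < t0 -> loewner_path U `[0, b] A Y,
    forall u, 0 <= u -> u < t0 -> `|A u - U u| <= phi t0 - phi u /\ Y u ^+ 2 <= 4 * (t0 - u) &
    forall u e, 0 <= u -> u < t0 -> 0 < e -> exists2 d, 0 < d & forall t A' Y',
      near_tip U t0 d t A' Y' -> (A' u - A u) ^+ 2 + (Y' u - Y u) ^+ 2 <= e].
Proof.
move=> sub; have [cU phiU [c [s1 [_ /andP[s10 s1t] _]]]] := sub.
have t00 : 0 < t0 by exact: lt_le_trans s1t.
have bex y : exists AY : (R -> R) * (R -> R), 0 < y ->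
    [/\ AY.1 t0 = U t0, AY.2 t0 = y & loewner_path U `]-oo, t0] AY.1 AY.2].
  have [y0|y0] := ltP 0 y; last by exists (cst 0, cst 0).
  by have [A [Y [h1 h2 h3]]] := backward_path_exists t0 (U t0) cU y0; exists (A, Y).
(* [z y] ends at height [y] above the singularity *)
pose z y := sval (cid (bex y)).
have zP y : 0 < y -> [/\ (z y).1 t0 = U t0, (z y).2 t0 = y & loewner_path U `]-oo, t0] (z y).1 (z y).2].
  by rewrite /z; case: cid.
have zI y u b : 0 < y -> b <= t0 -> loewner_path U `[u, b] (z y).1 (z y).2.
  move=> y0 bt; have [_ _] := zP y y0; apply: loewner_path_sub => x.
  by rewrite /= !in_itv/= => /andP[_ xb]; exact: le_trans bt.
have ztip y d : 0 < y -> y <= d -> near_tip U t0 d t0 (z y).1 (z y).2.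
  move=> y0 yd; have [h1 h2 _] := zP y y0; split; rewrite ?h1 ?h2 ?subrr ?normr0//.
  - by rewrite lexx andbT gerBl; exact: le_trans (ltW y0) yd.
  - exact: zI.
  - exact: le_trans (ltW y0) yd.
have zc u : 0 <= u -> u < t0 -> forall e, 0 < e -> exists2 d, 0 < d & forall y y',
    0 < y -> y <= d -> 0 < y' -> y' <= d ->
    `|(z y).1 u - (z y').1 u| <= e /\ `|(z y).2 u - (z y').2 u| <= e.
  move=> u0 ut e e0; have [d d0 Hd] := near_tip_contraction sub u0 ut (exprn_gt0 2 e0).
  exists d => // y y' y0 yd y0' yd'; apply: norm_le_sqr => //.
  by apply: Hd; apply: ztip.
have lim1 u : exists l, 0 <= u -> u < t0 -> forall e, 0 < e -> exists2 d, 0 < d &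
    forall y, 0 < y -> y <= d -> `|(z y).1 u - l| <= e.
  have [/andP[u0 ut]|nu] := pselect ((0 <= u) && (u < t0)); last first.
    by exists 0 => u0 ut; case: nu; rewrite u0 ut.
  have [|l Hl] := @right_limit_exists (fun y => (z y).1 u); last by exists l.
  move=> e e0; have [d d0 Hd] := zc u u0 ut e e0; exists d => // y y' h1 h2 h3 h4.
  by have [] := Hd y y' h1 h2 h3 h4.
have lim2 u : exists l, 0 <= u -> u < t0 -> forall e, 0 < e -> exists2 d, 0 < d &
    forall y, 0 < y -> y <= d -> `|(z y).2 u - l| <= e.
  have [/andP[u0 ut]|nu] := pselect ((0 <= u) && (u < t0)); last first.
    by exists 0 => u0 ut; case: nu; rewrite u0 ut.
  have [|l Hl] := @right_limit_exists (fun y => (z y).2 u); last by exists l.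
  move=> e e0; have [d d0 Hd] := zc u u0 ut e e0; exists d => // y y' h1 h2 h3 h4.
  by have [] := Hd y y' h1 h2 h3 h4.
pose A u := sval (cid (lim1 u)); pose Y u := sval (cid (lim2 u)).
have limA u e : 0 <= u -> u < t0 -> 0 < e -> exists2 d, 0 < d &
    forall y, 0 < y -> y <= d -> `|(z y).1 u - A u| <= e /\ `|(z y).2 u - Y u| <= e.
  move=> u0 ut e0; have [d1 d10 H1] := svalP (cid (lim1 u)) u0 ut e e0.
  have [d2 d20 H2] := svalP (cid (lim2 u)) u0 ut e e0.
  exists (Num.min d1 d2); first by rewrite lt_min d10.
  by move=> y y0; rewrite le_min => /andP[y1 y2]; split; [exact: H1|exact: H2].
have lims u e : 0 <= u -> u < t0 -> 0 < e -> exists2 d, 0 < d &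
    forall y, 0 < y -> y <= d -> ((z y).1 u - A u) ^+ 2 + ((z y).2 u - Y u) ^+ 2 <= e.
  move=> u0 ut e0; pose e' := Num.min 1 (e / 2).
  have e'0 : 0 < e' by rewrite lt_min ltr01 divr_gt0.
  have e'1 : e' <= 1 by rewrite ge_min lexx.
  have e'e : e' <= e / 2 by rewrite ge_min lexx orbT.
  have [d d0 Hd] := limA u e' u0 ut e'0; exists d => // y y0 yd.
  have [h1 h2] := Hd y y0 yd.
  have := sqr_le_norm (ltW e'0) h1 e'1; have := sqr_le_norm (ltW e'0) h2 e'1.
  by move: e'e; clear; lra.
clearbody A Y.
have Y0 u : 0 <= u -> u < t0 -> 0 < Y u.
  move=> u0 ut; have [d d0 [y0 y00 H]] := near_tip_im_lower sub u0 ut.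
  have y2 : 0 < y0 / 2 by rewrite divr_gt0.
  have [d' d'0 H'] := limA u _ u0 ut y2.
  pose y := Num.min d d'; have yp : 0 < y by rewrite lt_min d0.
  have yd : y <= d by rewrite ge_min lexx.
  have yd' : y <= d' by rewrite ge_min lexx orbT.
  have [_ h1] := H _ _ _ (ztip y d yp yd).
  have [_ ] := H' y yp yd'; rewrite ler_norml => /andP[_ h2].
  by move: h1 h2 y00; clear; lra.
exists A, Y; split.
- move=> b bt; have [b0|b0] := ltP b 0.
    by move=> t; rewrite /= in_itv/= => /andP[h1 h2]; move: (le_lt_trans (le_trans h1 h2) b0); rewrite ltxx.
  (* the limit is, up to time [b], the path through its own value at [b] *)
  have [A' [Y' [EA EY p]]] := backward_path_exists b (A b) cU (Y0 b b0 bt).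
  have p' u : loewner_path U `[u, b] A' Y'.
    by apply: loewner_path_sub p => x; rewrite /= !in_itv/= => /andP[].
  apply: loewner_path_ext (p' 0) => u; rewrite /= in_itv/= => /andP[u0 ub].
  have ut := le_lt_trans ub bt.
  suff : (A u - A' u) ^+ 2 + (Y u - Y' u) ^+ 2 <= 0.
    by move=> /sqr_sum_le0[h1 h2]; split; apply/eqP; rewrite -subr_eq0; apply/eqP.
  apply/ler_addgt0Pr => e e0; rewrite add0r.
  have e4 : 0 < e / 4 by rewrite divr_gt0.
  have [d1 d10 H1] := loewner_path_continuous ub e4 (p' u).
  have [d2 d20 H2] := limA b d1 b0 bt d10.
  have [d3 d30 H3] := lims u _ u0 ut e4.
  pose y := Num.min d2 d3; have yp : 0 < y by rewrite lt_min d20.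
  have y2 : y <= d2 by rewrite ge_min lexx.
  have y3 : y <= d3 by rewrite ge_min lexx orbT.
  have [k1 k2] := H2 y yp y2; rewrite -EA in k1; rewrite -EY in k2.
  have k3 := H1 _ _ (zI y u b yp (ltW bt)) k1 k2.
  have k4 := H3 y yp y3.
  apply: le_trans (sqr_sumB_le _ _ ((z y).1 u) ((z y).2 u) _ _) _.
  have sB (v w : R) : (v - w) ^+ 2 = (w - v) ^+ 2 by rewrite -sqrrN opprB.
  rewrite (sB (A u)) (sB (Y u)).
  by move: k3 k4; clear; lra.
- move=> u u0 ut.
  have zb y : 0 < y -> `|(z y).1 u - U u| <= phi t0 - phi u /\ (z y).2 u ^+ 2 <= y ^+ 2 + 4 * (t0 - u).
    move=> y0; have [h1 h2 _] := zP y y0; have p := zI y u t0 y0 (lexx _).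
    have cUu : {within `[u, t0], continuous U} by exact: continuous_subspaceT.
    have := loewner_path_re_le (ltW ut) cUu (dominates_increments_sub u0 (lexx _) phiU) p.
    have := loewner_path_im_sqr_le (ltW ut) p.
    by rewrite h1 h2 subrr normr0 add0r.
  have [Yu0 t0u] : 0 < Y u /\ 0 < t0 - u by rewrite Y0// subr_gt0.
  split; apply/ler_addgt0Pr => e e0.
    have [d d0 Hd] := limA u e u0 ut e0; have [h _] := Hd d d0 (lexx d).
    have [h1 _] := zb d d0.
    have -> : A u - U u = ((z d).1 u - U u) - ((z d).1 u - A u) by ring.
    by apply: le_trans (ler_normB _ _) _; exact: lerD.
  (* [Y u <= (z y).2 u + e'] with [e'] small relative to [Y u] *)
  pose e' := Num.min (Num.min 1 (Y u)) (e / (4 * (Y u + 1))).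
  have Yu1 : 0 < 4 * (Y u + 1) by move: Yu0; clear; lra.
  have e'0 : 0 < e' by rewrite !lt_min ltr01 Yu0 divr_gt0.
  have e'1 : e' <= 1 by rewrite !ge_min lexx.
  have e'Y : e' <= Y u by rewrite !ge_min lexx orbT.
  have e'e : e' * (4 * (Y u + 1)) <= e by rewrite -ler_pdivlMr// ge_min lexx orbT.
  have [d d0 Hd] := limA u e' u0 ut e'0.
  pose y := Num.min d e'; have yp : 0 < y by rewrite lt_min d0.
  have yd : y <= d by rewrite ge_min lexx.
  have ye : y <= e' by rewrite ge_min lexx orbT.
  have [_ ] := Hd y yp yd; rewrite ler_norml => /andP[h _].
  have [_ h1] := zb y yp.
  have h2 : y ^+ 2 <= e' by move: yp ye e'1; clear; nra.
  have h3 : (Y u - e') ^+ 2 <= (z y).2 u ^+ 2.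
    have h4 : Y u - e' <= (z y).2 u by move: h; clear; lra.
    rewrite ler_sqr ?nnegrE ?subr_ge0//.
    by apply: le_trans h4; rewrite subr_ge0.
  have h4 := mulr_ge0 (ltW e'0) (ltW Yu0).
  by have := sqr_ge0 e'; move: h1 h2 h3 h4 e'e e'0; clear; lra.
- move=> u e u0 ut e0.
  have e4 : 0 < e / 4 by rewrite divr_gt0.
  have [d1 d10 H1] := near_tip_contraction sub u0 ut e4.
  have [d2 d20 H2] := lims u _ u0 ut e4.
  exists d1 => // t A' Y' nt.
  pose y := Num.min d1 d2; have yp : 0 < y by rewrite lt_min d10.
  have y1 : y <= d1 by rewrite ge_min lexx.
  have y2 : y <= d2 by rewrite ge_min lexx orbT.
  have k1 := H1 _ _ _ _ _ _ nt (ztip y d1 yp y1).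
  have k2 := H2 y yp y2.
  apply: le_trans (sqr_sumB_le _ _ ((z y).1 u) ((z y).2 u) _ _) _.
  by move: k1 k2; clear; lra.
Qed.

End Trace.

(** * The topology of the complex plane in real coordinates *)

Section ComplexTopology.
Variable R : realType.
Implicit Types (z w l : R[i]) (e : R).

Lemma ReB z w : Re (z - w) = Re z - Re w. Proof. by case: z w => [a b] [c d]. Qed.
Lemma ImB z w : Im (z - w) = Im z - Im w. Proof. by case: z w => [a b] [c d]. Qed.

Lemma complex_eqP z w : Re z = Re w -> Im z = Im w -> z = w.
Proof. by case: z w => [a b] [c d] /= -> ->. Qed.

Lemma normc_lt z (e : R[i]) : 0 < e -> `|Re z| < Re e / 2 -> `|Im z| < Re e / 2 -> `|z| < e.
Proof.
move=> e0 h1 h2; rewrite normc_def ltcE /=.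
move: e0; rewrite ltcE /= => /andP[/eqP -> e0]; rewrite eqxx /=.
rewrite -[ltRHS]ger0_norm ?(ltW e0)// -sqrtr_sqr ltr_sqrt ?exprn_gt0//.
rewrite -[Re z ^+ 2]real_normK ?num_real// -[Im z ^+ 2]real_normK ?num_real//.
by have := normr_ge0 (Re z); have := normr_ge0 (Im z); move: h1 h2; clear; nra.
Qed.

Lemma normc_lt_Re_Im z e : `|z| < real_complex R e -> `|Re z| < e /\ `|Im z| < e.
Proof.
rewrite normc_def ltcE /= eqxx /= => h.
have e0 : 0 < e by apply: le_lt_trans h; exact: sqrtr_ge0.
split; apply: le_lt_trans h; rewrite -sqrtr_sqr ler_wsqrtr//.
  by rewrite lerDl sqr_ge0.
by rewrite lerDr sqr_ge0.
Qed.

Lemma cvg_complexP (T : Type) (F : set_system T) (FF : Filter F) (f : T -> R[i]) l :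
  f @ F --> l <->
  (fun x => Re (f x)) @ F --> Re l /\ (fun x => Im (f x)) @ F --> Im l.
Proof.
split=> [|[]] => [/cvgrPdist_lt H|/cvgrPdist_lt H1 /cvgrPdist_lt H2].
  split; apply/cvgrPdist_lt => e e0.
    have := H (real_complex R e); rewrite ltcR => /(_ e0); apply: filterS => x.
    by move=> /normc_lt_Re_Im[]; rewrite ReB.
  have := H (real_complex R e); rewrite ltcR => /(_ e0); apply: filterS => x.
  by move=> /normc_lt_Re_Im[]; rewrite ImB.
apply/cvgrPdist_lt => e e0.
have e2 : 0 < Re e / 2 by move: e0; rewrite ltcE /= => /andP[_ ?]; rewrite divr_gt0.
have := H1 _ e2; have := H2 _ e2; apply: filterS2 => x h2 h1.
by apply: normc_lt => //; rewrite ?ReB ?ImB.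
Qed.

Lemma unbounded_of_upper_half_plane (A : set R[i]) (M : R) :
  (forall z, M < Im z -> A z) -> ~ bounded_set A.
Proof.
move=> HA [N [Nr HN]].
pose K := Num.max (Re N) (Num.max M 0) + 1.
have KN : N < real_complex R K.
  move: Nr; rewrite realE lecE ltcE /= => h.
  have -> : Im N = 0.
    by move: h => /orP[|]; [|rewrite lecE/= eq_sym] => /andP[/eqP].
  by rewrite eqxx /K /= ltr_pwDr// le_max lexx.
have K0 : 0 <= K by rewrite /K addr_ge0// !le_max lexx !orbT.
have AK : A (Complex 0 (K + 1)).
  by apply: HA => /=; rewrite /K -addrA ltr_pwDr// !le_max lexx !orbT.
have K1 : 0 <= K + 1 by rewrite addr_ge0.
have /= := HN _ KN _ AK.
rewrite normc_def lecE /= expr0n add0r sqrtr_sqr eqxx /= ger0_norm//.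
by clear; lra.
Qed.

Lemma upper_half_plane_connected : connected (upper_half_plane R).
Proof.
pose seg (z : R[i]) := (fun t : R => Complex (t * Re z) (1 + t * (Im z - 1))) @` `[0, 1].
have -> : upper_half_plane R = \bigcup_(z in upper_half_plane R) seg z.
  apply/seteqP; split=> [z z0|w [z z0 [t]]].
    exists z => //; exists 1; first by rewrite /= in_itv/= ler01 lexx.
    by apply: complex_eqP => /=; ring.
  rewrite /= in_itv/= => /andP[t0 t1] <-; rewrite /upper_half_plane /= in z0 *.
  have [->|tn] := eqVneq t 0; first by rewrite mul0r addr0.
  have tp : 0 < t by rewrite lt_neqAle eq_sym tn.
  by have := mulr_gt0 tp z0; move: t1; clear; lra.
apply: bigcup_connected.
  exists (Complex 0 1) => z z0; exists 0; first by rewrite /= in_itv/= ler01 lexx.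
  by apply: complex_eqP => /=; ring.
move=> z _; apply: connected_continuous_connected; first exact: segment_connected.
apply: continuous_subspaceT => t; apply/cvg_complexP; split => /=.
  by apply: cvgM; [exact: cvg_id|exact: cvg_cst].
apply: cvgD; first exact: cvg_cst.
by apply: cvgM; [exact: cvg_id|exact: cvg_cst].
Qed.

End ComplexTopology.

(** * Solutions, lifetimes and paths *)

Section Solutions.
Variable R : realType.
Implicit Types (z w : R[i]) (e a b c d s t u x y : R) (I J : set R).
Implicit Types (U A Y : R -> R) (g : R -> R[i]).

Lemma velocity_complexE u x y :
  2 / (Complex x y - real_complex R u) = Complex (velx u x y) (vely u x y).
Proof.
have -> : (2 : R[i]) = Complex 2 0 by apply: complex_eqP => //=; rewrite addr0.
by apply: complex_eqP; rewrite /= /velx /vely ?subr0; ring.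
Qed.

Lemma quotient_complexE z w s :
  (z - w) / real_complex R s = Complex ((Re z - Re w) / s) ((Im z - Im w) / s).
Proof.
have E : s / (s ^+ 2 + 0 ^+ 2) = s^-1.
  have [->|s0] := eqVneq s 0; first by rewrite mul0r invr0.
  by rewrite expr0n addr0; field.
case: z w => [z1 z2] [w1 w2]; apply: complex_eqP; rewrite /= E mul0r oppr0; ring.
Qed.

(** The Loewner equation in real coordinates. *)
Lemma loewner_solutionP U z I g : loewner_solution U z I g <->
  g 0 = z /\ forall t, I t -> [/\ g t != real_complex R (U t),
    der_in I (fun s => Re (g s)) t (velx (U t) (Re (g t)) (Im (g t))) &
    der_in I (fun s => Im (g s)) t (vely (U t) (Re (g t)) (Im (g t)))].
Proof.
have E t : 2 / (g t - real_complex R (U t)) =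
    Complex (velx (U t) (Re (g t)) (Im (g t))) (vely (U t) (Re (g t)) (Im (g t))).
  by rewrite -velocity_complexE; congr (_ / (_ - _)); exact: complex_eqP.
have EQ t : (fun s => (g s - g t) / real_complex R (s - t)) =
    fun s => Complex ((Re (g s) - Re (g t)) / (s - t)) ((Im (g s) - Im (g t)) / (s - t)).
  by apply/funext => s; rewrite quotient_complexE.
split=> -[g0 H]; split=> // t It.
  have [gU] := H t It; rewrite E EQ => /cvg_complexP[h1 h2].
  by split => //; constructor.
have [gU [d1] [d2]] := H t It; split => //.
by rewrite E EQ; apply/cvg_complexP.
Qed.

Lemma loewner_solution_sub U z I J g : I `<=` J ->
  loewner_solution U z J g -> loewner_solution U z I g.
Proof.
move=> IJ /loewner_solutionP[g0 H]; apply/loewner_solutionP; split => // t It.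
by have [gU d1 d2] := H t (IJ _ It); split => //; exact: der_in_sub IJ _.
Qed.

Lemma loewner_path_solution U I A Y : loewner_path U I A Y ->
  loewner_solution U (Complex (A 0) (Y 0)) I (fun t => Complex (A t) (Y t)).
Proof.
move=> p; apply/loewner_solutionP; split => // t It; have [y0 dA dY] := p t It.
split => //; apply/eqP => -[_ y00]; by rewrite y00 ltxx in y0.
Qed.

Lemma der_in_continuous f (f' : R -> R) a b :
  (forall x, a <= x <= b -> der_in `[a, b] f x (f' x)) -> {within `[a, b], continuous f}.
Proof.
move=> df; apply/subspace_continuousP => x; rewrite /= in_itv/= => xab.
exact: der_in_cvg (df x xab).
Qed.

(** A solution started in the upper half-plane stays there: on a compact time
    interval it keeps away from the driving function, so that its imaginary part
    decays at most exponentially. *)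
Lemma loewner_solution_path U z b g : continuous U -> 0 <= b -> 0 < Im z ->
  loewner_solution U z `[0, b] g ->
  loewner_path U `[0, b] (fun t => Re (g t)) (fun t => Im (g t)).
Proof.
move=> cU b0 z0 /loewner_solutionP[g0 H].
pose A t := Re (g t); pose Y t := Im (g t).
pose N t := (A t - U t) ^+ 2 + Y t ^+ 2.
have dA t : 0 <= t <= b -> der_in `[0, b] A t (velx (U t) (A t) (Y t)).
  by move=> /mem_itvcc/H[].
have dY t : 0 <= t <= b -> der_in `[0, b] Y t (vely (U t) (A t) (Y t)).
  by move=> /mem_itvcc/H[].
have N0 t : 0 <= t <= b -> 0 < N t.
  move=> tb; have [gU _ _] := H t (mem_itvcc tb).
  rewrite lt_neqAle addr_ge0 ?sqr_ge0// andbT eq_sym; apply: contraNneq gU => N0.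
  have := sqr_ge0 (A t - U t); have := sqr_ge0 (Y t) => h1 h2.
  have [k1 k2] : A t - U t = 0 /\ Y t = 0 by apply: sqr_sum_le0; rewrite -/(N t) N0.
  by apply/eqP/complex_eqP => //=; apply/eqP; rewrite -subr_eq0; apply/eqP.
have cA := der_in_continuous dA; have cY := der_in_continuous dY.
have cUb : {within `[0, b], continuous U} by exact: continuous_subspaceT.
have cN : {within `[0, b], continuous N}.
  rewrite (_ : N = fun t => (A t - U t) * (A t - U t) + Y t * Y t); last first.
    by apply/funext => t; rewrite /N !expr2.
  move=> t; apply: cvgD; last by apply: cvgM; exact: cY.
  by apply: cvgM; (apply: cvgB; [exact: cA|exact: cUb]).
have [c cb Nc] := EVT_min b0 cN.
have c0b : 0 <= c <= b by move: cb; rewrite in_itv.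
have m0 := N0 c c0b.
suff Ypos t : 0 <= t <= b -> 0 < Y t.
  move=> t; rewrite /= in_itv/= => tb; split; [exact: Ypos|exact: dA|exact: dY].
move=> /andP[t0 tb]; rewrite ltNge; apply/negP => Yt.
have [r rt Yr] : exists2 r, r \in `[0, t] & Y r = 0.
  apply: IVT => //.
    exact: (continuous_subspaceW (itv_subset (lexx 0) tb)).
  have Y0 : 0 < Y 0 by rewrite /Y g0.
  by rewrite ge_min Yt orbT le_max (ltW Y0).
move: rt; rewrite in_itv/= => /andP[r0 rt].
have : Y 0 ^+ 2 <= 0.
  apply: (@gronwall0 _ (fun t => Y t ^+ 2) (fun t => 2 * Y t * vely (U t) (A t) (Y t))
    (4 / N c) 0 b r 0) => //.
  - by rewrite r0 (le_trans rt tb).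
  - by rewrite lexx b0.
  - by move=> x xb; apply: der_in_sqr; exact: dY.
  - move=> x xb; have Nx := N0 x xb.
    have -> : 2 * Y x * vely (U x) (A x) (Y x) = - (4 / N x * Y x ^+ 2).
      by rewrite /vely -/(N x); ring.
    rewrite normrN ger0_norm; last by rewrite mulr_ge0 ?sqr_ge0// divr_ge0// ltW.
    apply: ler_wpM2r; first exact: sqr_ge0.
    by rewrite ler_pM2l// lef_pV2 ?posrE//; apply: Nc; rewrite in_itv.
  - by rewrite Yr expr0n.
by apply/negP; rewrite -ltNge exprn_gt0// /Y g0.
Qed.

End Solutions.

Section Lifetime.
Variable R : realType.
Implicit Types (z w : R[i]) (T e a b c d s t u x y : R) (I J : set R).
Implicit Types (U A Y : R -> R) (g : R -> R[i]).

(** The solution started at [z] exists up to time [t] and stays in the upper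
    half-plane. *)
Definition flows_until U z t : Prop :=
  exists A Y, [/\ loewner_path U `[0, t] A Y, A 0 = Re z & Y 0 = Im z].

Lemma flows_until_le U z s t : s <= t -> flows_until U z t -> flows_until U z s.
Proof.
move=> st [A [Y [p A0 Y0]]]; exists A, Y; split => //.
exact: loewner_path_sub (itv_subset (lexx 0) st) p.
Qed.

Lemma flows_until0 U z : continuous U -> 0 < Im z -> flows_until U z 0.
Proof.
move=> cU z0; have [A [Y [A0 Y0 p]]] := backward_path_exists 0 (Re z) cU z0.
exists A, Y; split => //; apply: loewner_path_sub p => x.
by rewrite /= !in_itv/= => /andP[].
Qed.

(** A path on [[0, t]] extends beyond [t]: the truncated equation, at half the
    final height of the path, has a global solution that stays above this level
    for some time after [t]. *)
Lemma flows_until_extend U z t : continuous U -> 0 <= t -> flows_until U z t ->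
  exists2 t', t < t' & flows_until U z t'.
Proof.
move=> cU t0 [A [Y [p A0 Y0]]].
have tt : 0 <= t <= t by rewrite t0 lexx.
have [y0 _ _] := p t (mem_itvcc tt).
pose a := Y t / 2; have a0 : 0 < a by rewrite divr_gt0.
have [A' [Y' [A't Y't p']]] := truncated_path_exists t (A t) (Y t) cU a0.
have aY : a < Y' t by rewrite Y't /a; move: y0; clear; lra.
have [_ dY'] := p' t Logic.I.
have /cvg_withinP/(_ (Y' t - a)) := der_in_cvg dY'.
rewrite subr_gt0 => /(_ aY)[k k0 Hk].
have agree x : 0 <= x <= t -> A' x = A x /\ Y' x = Y x.
  move=> xt; apply: (@truncated_path_unique _ U a A' Y' A Y 0 t t x a0 t0) => //.
    exact: truncated_path_sub p'.
  apply: loewner_path_truncated (p) => u; rewrite /= in_itv/= => ut.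
  by apply: le_trans (loewner_path_im_ge ut p); rewrite /a; move: y0; clear; lra.
have z0 : 0 <= (0 : R) <= t by rewrite lexx.
have [A'0 Y'0] := agree 0 z0.
exists (t + k / 2); first by rewrite ltrDl divr_gt0.
exists A', Y'; split; [|by rewrite A'0|by rewrite Y'0].
apply: (truncated_path_loewner a0); last exact: truncated_path_sub p'.
move=> x; rewrite /= in_itv/= => /andP[x0 xk].
have [xt|tx] := leP x t.
  have xt' : 0 <= x <= t by rewrite x0.
  have [_ ->] := agree x xt'.
  by apply: le_trans (loewner_path_im_ge xt' p); rewrite /a; move: y0; clear; lra.
have := Hk x Logic.I; rewrite gtr0_norm ?subr_gt0//.
have xk' : x - t < k by move: xk k0; clear; lra.
by move=> /(_ xk'); rewrite ltr_norml => /andP[h _]; move: h; clear; lra.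
Qed.

(** For [z] in the upper half-plane, survival beyond [t <= T] means existence of
    a path on the closed interval [[0, t]]. *)
Lemma lifetime_gtP T U z t : continuous U -> 0 < T -> 0 < Im z -> 0 <= t -> t <= T ->
  (t%:E < loewner_lifetime T U z)%E <-> flows_until U z t.
Proof.
move=> cU T0 z0 t0 tT; rewrite /loewner_lifetime.
have -> : (z == 0) = false by apply/negP => /eqP zE; rewrite zE /= ltxx in z0.
have solflow b g : 0 <= b -> loewner_solution U z `[0, b] g -> flows_until U z b.
  move=> b0 sg; exists (fun t => Re (g t)), (fun t => Im (g t)).
  by split; [exact: (loewner_solution_path cU b0 z0 sg)|case: sg => ->|case: sg => ->].
have flowsol b : flows_until U z b -> exists g, loewner_solution U z `[0, b] g.
  move=> [A [Y [p A0 Y0]]]; exists (fun t => Complex (A t) (Y t)).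
  by have := loewner_path_solution p; rewrite A0 Y0; case: (z).
split.
  case: asboolP => [[g sg] _|_].
    by apply: flows_until_le tT _; apply: solflow sg; exact: ltW.
  move=> /ereal_sup_gt[_ [S [/andP[S0 ST] [g sg]] <-]]; rewrite lte_fin => tS.
  apply: (solflow _ g t0); apply: loewner_solution_sub sg => x.
  by rewrite /= !in_itv/= => /andP[-> xt]; exact: le_lt_trans tS.
move=> ft; case: asboolP => [_|nT]; first by rewrite ltry.
have tT' : t < T.
  by rewrite lt_neqAle tT andbT; apply: contra_notN nT => /eqP <-; exact: flowsol.
have [t' tt' ft'] := flows_until_extend cU t0 ft.
pose S := Num.min t' T.
have tS : t < S by rewrite lt_min tt'.
apply: lt_le_trans (_ : S%:E <= _)%E; first by rewrite lte_fin.
apply: ereal_sup_ubound; exists S => //; split.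
  by rewrite (le_trans t0 (ltW tS)) ge_min lexx orbT.
have [|g sg] := flowsol S; first by apply: flows_until_le ft'; rewrite ge_min lexx.
exists g; apply: loewner_solution_sub sg => x.
by rewrite /= !in_itv/= => /andP[-> /ltW].
Qed.

End Lifetime.

(** * Swallowed points and continuity of the trace *)

Section TraceProperties.
Variable R : realType.
Implicit Types (z w : R[i]) (T e a b c d s t u x y : R) (I J : set R).
Implicit Types (U phi A Y gA gY : R -> R) (g : R -> R[i]).

(** If the solution started at [z] dies at time [t], then it comes arbitrarily
    close to the driving function before [t]: otherwise its imaginary part would
    decay at most exponentially, hence stay above some level [a], and the
    solution of the equation truncated at [a] would extend it to [t]. *)
Lemma dying_path_near_tip U z t d : continuous U -> 0 < Im z -> 0 < t -> 0 < d ->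
  (forall s, 0 <= s -> s < t -> flows_until U z s) -> ~ flows_until U z t ->
  exists s A Y, [/\ near_tip U t d s A Y, A 0 = Re z & Y 0 = Im z].
Proof.
move=> cU z0 t0 d0 alive dead; apply: contrapT => far.
pose s0 := Num.max 0 (t - d).
have s00 : 0 <= s0 by rewrite le_max lexx.
have s0t : s0 < t by rewrite gt_max t0 ltrBlDr ltrDl.
have s0d : t - d <= s0 by rewrite le_max lexx orbT.
have away s A Y : s0 <= s -> s < t -> loewner_path U `[0, s] A Y -> A 0 = Re z ->
    Y 0 = Im z -> d ^+ 2 <= (A s - U s) ^+ 2 + Y s ^+ 2.
  move=> s0s st p A0 Y0; rewrite leNgt; apply/negP => lt; apply: far.
  exists s, A, Y; split=> //; split=> //.
  - by rewrite (le_trans s0d s0s) (ltW st).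
  - rewrite -ler_sqr ?nnegrE ?normr_ge0 ?(ltW d0)// real_normK ?num_real//.
    by have := sqr_ge0 (Y s); move: lt; clear; lra.
  - rewrite leNgt; apply/negP => dY.
    have : d ^+ 2 < Y s ^+ 2 by rewrite ltr_sqr ?nnegrE// ltW// (lt_trans d0).
    by have := sqr_ge0 (A s - U s); move: lt; clear; lra.
have [A0 [Y0 [p0 A00 Y00]]] := alive s0 s00 s0t.
have s0s0 : 0 <= s0 <= s0 by rewrite s00 lexx.
have [y0 _ _] := p0 s0 (mem_itvcc s0s0).
pose K := 2 / d ^+ 2; have K0 : 0 < K by rewrite divr_gt0// exprn_gt0.
pose a := Y0 s0 * expR (- (K * t)) / 2.
have a0 : 0 < a by rewrite divr_gt0// mulr_gt0// expR_gt0.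
have [A' [Y' [A'0 Y'0 p']]] := truncated_path_exists 0 (Re z) (Im z) cU a0.
have high s : s0 <= s -> s < t -> forall x, 0 <= x -> x <= s -> 2 * a <= Y' x.
  move=> s0s st; have s0' := le_trans s00 s0s.
  have [A [Y [p A_0 Y_0]]] := alive s s0' st.
  have [EA EY] : A s0 = A0 s0 /\ Y s0 = Y0 s0.
    apply: (@loewner_path_unique _ U A Y A0 Y0 0 s0 0 s0) => //.
    - exact: loewner_path_sub (itv_subset (lexx 0) s0s) p.
    - by rewrite lexx s00.
    - by rewrite A_0 A00.
    - by rewrite Y_0 Y00.
  have Ys : 2 * a <= Y s.
    have : expR (K * s0) * Y s0 <= expR (K * s) * Y s.
      apply: (@der_in_ndecr _ (fun t => expR (K * t) * Y t)
        (fun x => K * expR (K * x) * Y x + expR (K * x) * vely (U x) (A x) (Y x))) => // x xs.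
        have xs' : `[0, s]%classic x.
          by apply: mem_itvcc; case/andP: xs => x1 ->; rewrite (le_trans s00 x1).
        have [_ _ dY] := p x xs'.
        by apply: der_inM; [exact: der_in_expR|exact: der_in_sub (itv_subset s00 (lexx s)) dY].
      have [x1 x2] := andP xs.
      have x0 := le_trans s00 x1.
      have px := loewner_path_sub (itv_subset (lexx 0) x2) p.
      have N := away x A Y x1 (le_lt_trans x2 st) px A_0 Y_0.
      have xx : 0 <= x <= x by rewrite x0 lexx.
      have [yx _ _] := px x (mem_itvcc xx).
      have -> : K * expR (K * x) * Y x + expR (K * x) * vely (U x) (A x) (Y x) =
        expR (K * x) * (Y x * (K - 2 / ((A x - U x) ^+ 2 + Y x ^+ 2))).
        by rewrite /vely; ring.
      rewrite mulr_ge0 ?expR_ge0// mulr_ge0 ?(ltW yx)// subr_ge0 /K ler_pM2l//.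
      by rewrite lef_pV2 ?posrE ?exprn_gt0//; apply: lt_le_trans N; rewrite exprn_gt0.
    rewrite EY => h.
    have E2a : 2 * a = Y0 s0 * expR (- (K * t)) by rewrite /a mulrC divfK.
    rewrite E2a -(ler_pM2l (expR_gt0 (K * s))); apply: le_trans h.
    rewrite mulrCA -expRD mulrC ler_pM2r// ler_expR -subr_ge0.
    have -> : K * s0 - (K * s - K * t) = K * (s0 + (t - s)) by ring.
    by rewrite mulr_ge0 ?(ltW K0)// addr_ge0// subr_ge0 ltW.
  move=> x x0 xs.
  have Yx u : 0 <= u <= s -> 2 * a <= Y u.
    by move=> us; apply: le_trans Ys _; exact: (loewner_path_im_ge us p).
  have [_ ->] : A' x = A x /\ Y' x = Y x.
    apply: (@truncated_path_unique _ U a A' Y' A Y 0 s 0 x a0 s0') => //.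
    - exact: truncated_path_sub p'.
    - apply: loewner_path_truncated (p) => u; rewrite /= in_itv/= => us.
      by apply: le_trans (Yx u us); move: a0; clear; lra.
    - by rewrite lexx.
    - by rewrite x0.
    - by rewrite A'0 A_0.
    - by rewrite Y'0 Y_0.
  by apply: Yx; rewrite x0.
have high' x : 0 <= x -> x < t -> 2 * a <= Y' x.
  move=> x0 xt; have [xs|sx] := leP x s0; first exact: (high s0).
  exact: (high x (ltW sx)).
apply: dead; exists A', Y'; split => //.
apply: (truncated_path_loewner a0); last exact: truncated_path_sub p'.
move=> x; rewrite /= in_itv/= => /andP[x0]; rewrite le_eqVlt => /orP[/eqP ->|xt]; last first.
  by apply: le_trans (high' x x0 xt); move: a0; clear; lra.
have [_ dY'] := p' t Logic.I.
have /cvg_withinP/(_ _ a0)[k k0 Hk] := der_in_cvg dY'.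
pose s := Num.max 0 (t - k / 2).
have s0' : 0 <= s by rewrite le_max lexx.
have k2 : 0 < k / 2 by rewrite divr_gt0.
have st : s < t by rewrite gt_max t0 ltrBlDr ltrDl.
have sk : t - k / 2 <= s by rewrite le_max lexx orbT.
have := Hk s Logic.I; rewrite ltr0_norm ?subr_lt0// opprB.
have tsk : t - s < k by move: sk k0; clear; lra.
move=> /(_ tsk); rewrite ltr_norml => /andP[_ h].
by have := high' s s0' st; move: h a0; clear; lra.
Qed.

(** Continuity in [t] of the endpoint [gA t + i gY t], which by hypothesis is
    the limit of the initial points of the paths that end near the singularity
    at [t]. A path ending just above the singularity at a time [s] close to [t]
    ends, or passes, near the singularity at [t], whether [s <= t] or [t < s]. *)
Lemma trace_continuous U phi T gA gY : continuous U -> U 0 = 0 ->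
  (forall t, 0 < t -> t <= T -> dominates_increments phi U 0 t) ->
  (forall t e, 0 <= t -> t < T -> 0 < e -> exists2 d, 0 < d &
    forall s, t <= s -> s <= T -> s - t < d -> phi s - phi t <= e) ->
  gA 0 = 0 -> gY 0 = 0 ->
  (forall t, 0 < t -> t <= T -> `|gA t - U 0| <= phi t - phi 0 /\ gY t ^+ 2 <= 4 * (t - 0)) ->
  (forall t e, 0 < t -> t <= T -> 0 < e -> exists2 d, 0 < d & forall s A' Y',
      near_tip U t d s A' Y' -> (A' 0 - gA t) ^+ 2 + (Y' 0 - gY t) ^+ 2 <= e) ->
  forall t e, 0 <= t -> t <= T -> 0 < e -> exists2 d, 0 < d & forall s,
    0 <= s -> s <= T -> `|s - t| < d -> (gA s - gA t) ^+ 2 + (gY s - gY t) ^+ 2 <= e.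
Proof.
move=> cU U0 phiU phir gA0 gY0 bnd tip t e t0 tT e0.
have [->|tn0] := eqVneq t 0.
  have [T0|T0] := ltP 0 T; last first.
    exists 1 => // s s0 sT _; have -> : s = 0 by apply/eqP; rewrite eq_le s0 (le_trans sT T0).
    by rewrite !subrr expr0n addr0 ltW.
  pose e' := Num.min 1 (e / 2).
  have e'0 : 0 < e' by rewrite lt_min ltr01 divr_gt0.
  have e'1 : e' <= 1 by rewrite ge_min lexx.
  have e'e : e' <= e / 2 by rewrite ge_min lexx orbT.
  have [d d0 Hd] := phir 0 e' (lexx 0) T0 e'0.
  exists (Num.min d (e / 8)); first by rewrite lt_min d0 divr_gt0.
  move=> s s0 sT; rewrite subr0 ger0_norm// lt_min => /andP[sd se].
  rewrite gA0 gY0 !subr0.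
  have [->|sn0] := eqVneq s 0; first by rewrite gA0 gY0 expr0n addr0 ltW.
  have sp : 0 < s by rewrite lt_neqAle eq_sym sn0.
  have [b1 b2] := bnd s sp sT; rewrite U0 !subr0 in b1 b2.
  have hp : phi s - phi 0 <= e' by apply: Hd => //; rewrite subr0.
  have := sqr_le_norm (ltW e'0) (le_trans b1 hp) e'1.
  by move: b2 se e'e; clear; lra.
have tp : 0 < t by rewrite lt_neqAle eq_sym tn0.
have e4 : 0 < e / 4 by rewrite divr_gt0.
have [d d0 Hd] := tip t _ tp tT e4.
(* any time close to [t] carries a path that is near the singularity at [t] and
   starts close to the endpoint at that time *)
suff [k k0 Hk] : exists2 k, 0 < k & forall s, 0 < s -> s <= T -> `|s - t| < k ->
    forall d', 0 < d' -> exists s' A Y, near_tip U t d s' A Y /\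
      exists s'', near_tip U s d' s'' A Y.
  exists (Num.min k t); first by rewrite lt_min k0.
  move=> s s0 sT; rewrite lt_min => /andP[sk st].
  have sp : 0 < s by move: st; rewrite ltr_norml => /andP[]; clear; lra.
  have [d' d'0 Hd'] := tip s _ sp sT e4.
  have [s' [A [Y [nt [s'' nt']]]]] := Hk s sp sT sk d' d'0.
  have k1 := Hd _ _ _ nt; have k2 := Hd' _ _ _ nt'.
  apply: le_trans (sqr_sumB_le _ _ (A 0) (Y 0) _ _) _.
  have sB (v w : R) : (v - w) ^+ 2 = (w - v) ^+ 2 by rewrite -sqrrN opprB.
  by rewrite (sB (gA s)) (sB (gY s)); move: k1 k2; clear; lra.
have pathat s y : 0 < y -> exists A Y,
    [/\ A s = U s, Y s = y & forall u b, b <= s -> loewner_path U `[u, b] A Y].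
  move=> y0; have [A [Y [h1 h2 p]]] := backward_path_exists s (U s) cU y0.
  exists A, Y; split => // u b bs; apply: loewner_path_sub p => x.
  by rewrite /= !in_itv/= => /andP[_ xb]; exact: le_trans bs.
have [k1 k10 Hk1] : exists2 k, 0 < k & forall s, t <= s -> s <= T -> s - t < k -> phi s - phi t <= d.
  have [tT'|tT'] := ltP t T; first exact: phir.
  exists 1 => // s ts sT _; have -> : s = t by apply/eqP; rewrite eq_le ts (le_trans sT tT').
  by rewrite subrr ltW.
exists (Num.min (Num.min k1 d) (d ^+ 2 / 8)).
  by rewrite !lt_min k10 d0 divr_gt0// exprn_gt0.
move=> s s0 sT; rewrite !lt_min => /andP[/andP[sk1 sd] sdd] d' d'0.
pose y := Num.min d' (d / 2).
have y0 : 0 < y by rewrite lt_min d'0 divr_gt0.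
have yd' : y <= d' by rewrite ge_min lexx.
have yd : y <= d / 2 by rewrite ge_min lexx orbT.
have [A [Y [As Ys p]]] := pathat s y y0.
have nts : near_tip U s d' s A Y.
  split; rewrite ?As ?Ys ?subrr ?normr0 ?(ltW d'0)//; last exact: p.
  by rewrite lexx andbT gerBl ltW.
have [st|ts] := leP s t.
  exists s, A, Y; split; last by exists s.
  split; rewrite ?As ?Ys ?subrr ?normr0 ?(ltW d0)//.
  - rewrite st andbT; move: sd; rewrite ltr_norml => /andP[h _]; move: h; clear; lra.
  - exact: p.
  - by move: yd d0; clear; lra.
exists t, A, Y; split; last by exists s.
have pt := p t s (lexx s).
have cUt : {within `[t, s], continuous U} by exact: continuous_subspaceT.
have dom := dominates_increments_sub t0 (lexx s) (phiU s s0 sT).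
rewrite gtr0_norm ?subr_gt0// in sk1 sd sdd.
have tt : t <= t <= s by rewrite lexx ltW.
split.
- by rewrite lexx andbT gerBl ltW.
- exact: p _ _ (ltW ts).
- have := loewner_path_re_le (ltW ts) cUt dom pt.
  rewrite As subrr normr0 add0r => h; apply: le_trans h _; exact: Hk1 (ltW ts) sT sk1.
- have := loewner_path_im_sqr_le (ltW ts) pt; rewrite Ys => h.
  have [yt _ _] := pt t (mem_itvcc tt).
  rewrite -ler_sqr ?nnegrE ?(ltW yt) ?(ltW d0)//; apply: le_trans h _.
  have : y ^+ 2 <= (d / 2) ^+ 2 by rewrite ler_sqr ?nnegrE ?(ltW y0)// divr_ge0// ltW.
  by have := sqr_ge0 d; move: sdd; clear; lra.
Qed.

End TraceProperties.

(** * The simple trace for a continuous driving function *)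

Section Main.
Variable R : realType.
Implicit Types (z w : R[i]) (T e a b c d s t u x y : R) (I J : set R).
Implicit Types (U V phi A Y : R -> R) (g : R -> R[i]).

(** The points surviving after time [t] form a continuous image of the half-plane. *)
Lemma survivors_connected U t : continuous U -> 0 <= t ->
  connected [set z | 0 < Im z /\ flows_until U z t].
Proof.
move=> cU t0.
have bex w : exists AY : (R -> R) * (R -> R), 0 < Im w ->
    [/\ AY.1 t = Re w, AY.2 t = Im w & loewner_path U `[0, t] AY.1 AY.2].
  have [w0|w0] := ltP 0 (Im w); last by exists (cst 0, cst 0).
  have [A [Y [h1 h2 p]]] := backward_path_exists t (Re w) cU w0.
  exists (A, Y) => _; split => //; apply: loewner_path_sub p => x.
  by rewrite /= !in_itv/= => /andP[].
pose z w := sval (cid (bex w)).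
have zP w : 0 < Im w -> [/\ (z w).1 t = Re w, (z w).2 t = Im w &
    loewner_path U `[0, t] (z w).1 (z w).2] by rewrite /z; case: cid.
pose f w := Complex ((z w).1 0) ((z w).2 0).
have t00 : 0 <= (0 : R) <= t by rewrite lexx.
have tt : 0 <= t <= t by rewrite lexx t0.
have -> : [set z | 0 < Im z /\ flows_until U z t] = f @` upper_half_plane R.
  apply/seteqP; split=> [v [v0 [A [Y [p A0 Y0]]]]|_ [w w0 <-]].
    have [yt _ _] := p t (mem_itvcc tt).
    pose w := Complex (A t) (Y t); exists w => //.
    have [h1 h2 p'] := zP w yt.
    have [E1 E2] := @loewner_path_unique _ U _ _ A Y 0 t t 0 t0 p' p tt t00 h1 h2.
    by apply: complex_eqP; rewrite /= ?E1 ?E2.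
  have [h1 h2 p] := zP w w0; have [y0 _ _] := p 0 (mem_itvcc t00).
  by split => //; exists (z w).1, (z w).2.
apply: connected_continuous_connected; first exact: upper_half_plane_connected.
apply/subspace_continuousP => w w0.
have [h1 h2 p] := zP w w0.
have /cvg_complexP[/cvgrPdist_le cRe /cvgrPdist_le cIm] : (fun v : R[i] => v) @ w --> w.
  exact: cvg_id.
have key e : 0 < e -> \forall v \near within (upper_half_plane R) (nbhs w),
    `|(z v).1 0 - (z w).1 0| <= e /\ `|(z v).2 0 - (z w).2 0| <= e.
  move=> e0; have [d d0 Hd] := loewner_path_continuous t0 (exprn_gt0 2 e0) p.
  rewrite near_withinE; have := cRe _ d0; have := cIm _ d0.
  apply: filterS2 => v kI kR v0; have [k1 k2 p'] := zP v v0.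
  apply: norm_le_sqr => //; apply: Hd => //.
    by rewrite k1 h1 distrC.
  by rewrite k2 h2 distrC.
apply/cvg_complexP; split; apply/cvgrPdist_le => e e0.
  by have := key e e0; apply: filterS => v [k _]; rewrite distrC.
by have := key e e0; apply: filterS => v [_ k]; rewrite distrC.
Qed.

Lemma closure_upper_half_plane0 : closure (upper_half_plane R) 0.
Proof.
move=> B B0.
have : Complex 0 y @[y --> (0 : R)^'+] --> (0 : R[i]).
  apply/cvg_complexP; split => /=; first exact: cvg_cst.
  exact: (cvg_at_right_filter cvg_id).
move=> /(_ B B0) H; change (\forall y \near (0 : R)^'+, B (Complex 0 y)) in H.
have H2 : \forall y \near (0 : R)^'+, 0 < y by exact: nbhs_right_gt.
have [y [By y0]] := @filter_ex _ _ _ _ (filterI H H2).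
by exists (Complex 0 y); split.
Qed.

(** The result for a driving function that is continuous on the whole line, with
    a right-continuous function [phi] in place of the total variation. *)
Theorem simple_trace_of_subcritical U phi T : continuous U -> U 0 = 0 -> 0 < T ->
  (forall t, 0 < t -> t <= T -> subcritical_at phi U t) ->
  (forall t e, 0 <= t -> t < T -> 0 < e -> exists2 d, 0 < d &
    forall s, t <= s -> s <= T -> s - t < d -> phi s - phi t <= e) ->
  exists gamma : R -> R[i],
    [/\ is_trace T (loewner_chain T U) gamma,
        {in `[0, T] &, injective gamma} &
        forall t : R, 0 < t <= T -> upper_half_plane R (gamma t)].
Proof.
move=> cU U0 T0 sub phir.
have bex t : exists AY : (R -> R) * (R -> R), 0 < t -> t <= T ->
  [/\ forall b, b < t -> loewner_path U `[0, b] AY.1 AY.2,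
    forall u, 0 <= u -> u < t -> `|AY.1 u - U u| <= phi t - phi u /\ AY.2 u ^+ 2 <= 4 * (t - u) &
    forall u e, 0 <= u -> u < t -> 0 < e -> exists2 d, 0 < d & forall s A' Y',
      near_tip U t d s A' Y' -> (A' u - AY.1 u) ^+ 2 + (Y' u - AY.2 u) ^+ 2 <= e].
  have [/andP[t0 tT]|nt] := pselect ((0 < t) && (t <= T)); last first.
    by exists (cst 0, cst 0) => t0 tT; case: nt; rewrite t0 tT.
  by have [A [Y H]] := tip_path_exists (sub t t0 tT); exists (A, Y).
pose Z t := sval (cid (bex t)).
have ZP t : 0 < t -> t <= T ->
  [/\ forall b, b < t -> loewner_path U `[0, b] (Z t).1 (Z t).2,
    forall u, 0 <= u -> u < t -> `|(Z t).1 u - U u| <= phi t - phi u /\ (Z t).2 u ^+ 2 <= 4 * (t - u) &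
    forall u e, 0 <= u -> u < t -> 0 < e -> exists2 d, 0 < d & forall s A' Y',
      near_tip U t d s A' Y' -> (A' u - (Z t).1 u) ^+ 2 + (Y' u - (Z t).2 u) ^+ 2 <= e].
  by rewrite /Z; case: cid.
clearbody Z.
pose gA t := if 0 < t then (Z t).1 0 else 0.
pose gY t := if 0 < t then (Z t).2 0 else 0.
pose gamma t := Complex (gA t) (gY t).
have gA0 : gA 0 = 0 by rewrite /gA ltxx.
have gY0 : gY 0 = 0 by rewrite /gY ltxx.
have gAE t : 0 < t -> gA t = (Z t).1 0 by rewrite /gA => ->.
have gYE t : 0 < t -> gY t = (Z t).2 0 by rewrite /gY => ->.
have gYpos t : 0 < t -> t <= T -> 0 < gY t.
  move=> t0 tT; have [p _ _] := ZP t t0 tT; rewrite gYE//.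
  have z0 : 0 <= (0 : R) <= 0 by rewrite lexx.
  by have [] := p 0 t0 0 (mem_itvcc z0).
have tip t e : 0 < t -> t <= T -> 0 < e -> exists2 d, 0 < d & forall s A' Y',
      near_tip U t d s A' Y' -> (A' 0 - gA t) ^+ 2 + (Y' 0 - gY t) ^+ 2 <= e.
  move=> t0 tT e0; have [_ _ H] := ZP t t0 tT; rewrite gAE// gYE//.
  exact: (H 0 e (lexx 0) t0 e0).
have bnd t : 0 < t -> t <= T -> `|gA t - U 0| <= phi t - phi 0 /\ gY t ^+ 2 <= 4 * (t - 0).
  by move=> t0 tT; have [_ H _] := ZP t t0 tT; rewrite gAE// gYE//; exact: H.
have dom t : 0 < t -> t <= T -> dominates_increments phi U 0 t.
  by move=> t0 tT; have [] := sub t t0 tT.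
have cont := trace_continuous cU U0 dom phir gA0 gY0 bnd tip.
(* the point [gamma t] is swallowed exactly at time [t] *)
have alive t s : 0 < t -> t <= T -> s < t -> flows_until U (gamma t) s.
  move=> t0 tT st; have [p _ _] := ZP t t0 tT.
  by exists (Z t).1, (Z t).2; split; [exact: p|rewrite /= gAE|rewrite /= gYE].
have dead t : 0 < t -> t <= T -> ~ flows_until U (gamma t) t.
  move=> t0 tT [A [Y [p A0 Y0]]]; have [q H _] := ZP t t0 tT.
  have tt : 0 <= t <= t by rewrite lexx ltW.
  have [y0 _ _] := p t (mem_itvcc tt).
  pose b := Num.max 0 (t - Y t ^+ 2 / 8).
  have b0 : 0 <= b by rewrite le_max lexx.
  have bt : b < t by rewrite gt_max t0 ltrBlDr ltrDl divr_gt0// exprn_gt0.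
  have bY : t - Y t ^+ 2 / 8 <= b by rewrite le_max lexx orbT.
  have [_ E] : A b = (Z t).1 b /\ Y b = (Z t).2 b.
    apply: (@loewner_path_unique _ U _ _ _ _ 0 b 0 b b0 _ (q b bt)) => //.
    - exact: loewner_path_sub (itv_subset (lexx 0) (ltW bt)) p.
    - by rewrite lexx b0.
    - by rewrite b0 lexx.
    - by rewrite A0 /= gAE.
    - by rewrite Y0 /= gYE.
  have [_ h] := H b b0 bt; rewrite -E in h.
  have btt : 0 <= b <= t by rewrite b0 ltW.
  have h2 : Y t ^+ 2 <= Y b ^+ 2.
    have h3 := loewner_path_im_ge btt p.
    by rewrite ler_sqr ?nnegrE ?(ltW y0)// (le_trans (ltW y0)).
  by have := exprn_gt0 2 y0; move: h h2 bY; clear; lra.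
have lifeP z t : 0 < Im z -> 0 <= t -> t <= T ->
    (loewner_lifetime T U z <= t%:E)%E <-> ~ flows_until U z t.
  move=> z0 t0 tT; rewrite leNgt; split; first by move=> /negP h /(lifetime_gtP cU T0 z0 t0 tT).
  by move=> h; apply/negP => /(lifetime_gtP cU T0 z0 t0 tT).
(* the hull and the curve leave the same points of the half-plane *)
have survive t : 0 <= t -> t <= T -> upper_half_plane R `\` loewner_chain T U t =
    [set z | 0 < Im z /\ flows_until U z t].
  move=> t0 tT; apply/seteqP; split=> z.
    move=> [z0 nK]; split => //; apply: contrapT => h; apply: nK; split.
      exact: subset_closure.
    exact/lifeP.
  by move=> [z0 h]; split => // -[_ /lifeP]; exact.
have swallowed t : 0 <= t -> t <= T -> upper_half_plane R `\` gamma @` `[0, t] =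
    [set z | 0 < Im z /\ flows_until U z t].
  move=> t0 tT; apply/seteqP; split=> z.
    move=> [z0 ng]; split => //; apply: contrapT => /(lifeP z t z0 t0 tT) h; apply: ng.
    have h0 : (0%:E < loewner_lifetime T U z)%E.
      by apply/(lifetime_gtP cU T0 z0 (lexx 0) (ltW T0)); exact: flows_until0.
    have [tau tauE] : exists tau : R, loewner_lifetime T U z = tau%:E.
      by move: h h0; case: (loewner_lifetime T U z) => // r _ _; exists r.
    rewrite tauE !lte_fin in h0; rewrite tauE lee_fin in h.
    have tauT := le_trans h tT.
    exists tau; first by rewrite /= in_itv/= (ltW h0).
    have close e : 0 < e -> (Re z - gA tau) ^+ 2 + (Im z - gY tau) ^+ 2 <= e.
      move=> e0; have [d d0 Hd] := tip tau e h0 tauT e0.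
      have [||s [A [Y [nt <- <-]]]] := @dying_path_near_tip _ U z tau d cU z0 h0 d0.
      - move=> s s0 st; apply/(lifetime_gtP cU T0 z0 s0 (le_trans (ltW st) tauT)).
        by rewrite tauE lte_fin.
      - by apply/lifeP; rewrite ?tauE// ltW.
      - exact: Hd nt.
    have /sqr_sum_le0[h1 h2] : (Re z - gA tau) ^+ 2 + (Im z - gY tau) ^+ 2 <= 0.
      by apply/ler_addgt0Pr => e e0; rewrite add0r; exact: close.
    by apply: complex_eqP => /=; apply/esym/eqP; rewrite -subr_eq0; apply/eqP.
  move=> [z0 ft]; split => // -[s /=]; rewrite in_itv/= => /andP[s0 st] E.
  rewrite -E in z0 ft.
  have sp : 0 < s.
    rewrite lt_neqAle s0 andbT; apply: contraTneq z0 => <-.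
    by rewrite /= gY0 ltxx.
  by apply: (dead s sp (le_trans st tT)); exact: flows_until_le st ft.
have Im_gt0 t : 0 < t <= T -> upper_half_plane R (gamma t).
  by move=> /andP[t0 tT]; exact: gYpos.
exists gamma; split => //.
- split.
  + apply/subspace_continuousP => t; rewrite /= in_itv/= => /andP[t0 tT].
    have key e : 0 < e -> \forall s \near within `[0, T] (nbhs t),
        `|gA s - gA t| <= e /\ `|gY s - gY t| <= e.
      move=> e0; have [d d0 Hd] := cont t _ t0 tT (exprn_gt0 2 e0).
      rewrite near_withinE; exists d => //= s; rewrite /ball/= distrC => sd.
      by rewrite in_itv/= => /andP[s0 sT]; apply: norm_le_sqr => //; exact: Hd.
    apply/cvg_complexP; split; apply/cvgrPdist_le => e e0 /=.
      by have := key e e0; apply: filterS => v [k _]; rewrite distrC.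
    by have := key e e0; apply: filterS => v [_ k]; rewrite distrC.
  + move=> t /andP[t0 tT]; have [->|tn0] := eqVneq t 0.
      by rewrite /gamma gA0 gY0; exact: closure_upper_half_plane0.
    by apply: subset_closure; apply: Im_gt0; rewrite tT lt_neqAle eq_sym tn0 t0.
  + by rewrite /gamma gA0 gY0.
  + move=> t /andP[t0 tT].
    have conn := survivors_connected cU t0.
    have unb : ~ bounded_set [set z | 0 < Im z /\ flows_until U z t].
      apply: (@unbounded_of_upper_half_plane _ _ (T + 1)) => z zT.
      rewrite -swallowed//; split.
        by rewrite /upper_half_plane /=; apply: lt_trans zT; rewrite addr_gt0.
      move=> [s /=]; rewrite in_itv/= => /andP[s0 st] E.
      move: zT; rewrite -E /=; apply/negP; rewrite -leNgt.
      have [->|sn0] := eqVneq s 0; first by rewrite gY0 addr_ge0// ltW.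
      have sp : 0 < s by rewrite lt_neqAle eq_sym sn0.
      have sT := le_trans st tT.
      have [_ h] := bnd s sp sT; have g0 := gYpos s sp sT.
      rewrite -ler_sqr ?nnegrE ?(ltW g0) ?addr_ge0 ?(ltW T0)//.
      by have := sqr_ge0 (T - 1); move: h sT; clear; lra.
    rewrite /is_the_unbounded_component survive// swallowed//.
    set S := [set z | _ /\ _] in conn unb *.
    apply/seteqP; split=> [D [[x Sx ->] _] /=|_ /= ->].
      exact: connected_component_id.
    split=> //; have [x Sx] : S !=set0.
      apply/set0P; apply/negP => /eqP S0; apply: unb; rewrite S0.
      by exists 0; split; [exact: real0|move=> M _ x].
    by exists x => //; rewrite connected_component_id.
- have lt_neq s t : 0 <= s -> s < t -> t <= T -> gamma s = gamma t -> False.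
    move=> s0 st tT E; have t0 : 0 < t by exact: le_lt_trans st.
    have [sz|sn0] := eqVneq s 0.
      have := gYpos t t0 tT; have : Im (gamma s) = Im (gamma t) by rewrite E.
      by rewrite /= sz gY0 => <-; rewrite ltxx.
    have sp : 0 < s by rewrite lt_neqAle eq_sym sn0.
    apply: (dead s sp (le_trans (ltW st) tT)); rewrite E; exact: alive.
  move=> s t; rewrite !in_itv/= => /andP[s0 sT] /andP[t0 tT] E.
  by case: (ltgtP s t) => // [st|ts]; exfalso; [exact: (lt_neq s t)|exact: (lt_neq t s)].
Qed.

End Main.

(** * From functions of bounded variation to continuous driving functions *)

Section Reduction.
Variable R : realType.
Implicit Types (T e a b c d s t u x y : R) (U V phi : R -> R).

(** Projection of the time line onto [[0, T]]. *)
Definition clamp T t : R := Num.max 0 (Num.min t T).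

Lemma clamp_itv T t : 0 < T -> 0 <= clamp T t <= T.
Proof. by move=> T0; rewrite /clamp le_max lexx ge_max (ltW T0) ge_min lexx orbT. Qed.

Lemma clamp_id T t : 0 <= t -> t <= T -> clamp T t = t.
Proof. by move=> t0 tT; rewrite /clamp min_l// max_r. Qed.

Lemma clamp_lip T s t : `|clamp T s - clamp T t| <= `|s - t|.
Proof.
rewrite /clamp ![Num.max 0 _]maxC; apply: le_trans (maxr_lip _ _ _) _.
exact: minr_lip.
Qed.

Lemma continuous_clamp T U : 0 < T -> {within `[0, T], continuous U} ->
  continuous (fun t => U (clamp T t)).
Proof.
move=> T0 /subspace_continuousP cU t; apply/cvgrPdist_lt => e e0.
have /cvg_withinP/(_ e e0)[k k0 Hk] := cU _ (mem_itvcc (clamp_itv t T0)).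
exists k => //= s; rewrite /ball/= distrC => st.
rewrite distrC; apply: Hk; first exact: mem_itvcc (clamp_itv s T0).
exact: le_lt_trans (clamp_lip _ _ _) st.
Qed.

Lemma loewner_solution_eq_driver U V z (I : set R) g : (forall t, I t -> U t = V t) ->
  loewner_solution U z I g -> loewner_solution V z I g.
Proof.
move=> UV /loewner_solutionP[g0 H]; apply/loewner_solutionP; split=> [|t It]; first exact: g0.
by have := H t It; rewrite (UV t It).
Qed.

(** The chain depends only on the values of the driving function on [[0, T]]. *)
Lemma loewner_chain_eq_driver T U V : (forall t, 0 <= t -> t <= T -> U t = V t) ->
  loewner_chain T U = loewner_chain T V.
Proof.
move=> UV; suff E : loewner_lifetime T U = loewner_lifetime T V by rewrite /loewner_chain E.
apply: funext => z.
have iff (I : set R) : I `<=` `[0, T] ->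
    (exists g, loewner_solution U z I g) = (exists g, loewner_solution V z I g).
  move=> IT; have UVI s : I s -> U s = V s.
    by move=> /IT; rewrite /= in_itv/= => /andP[s0 sT]; exact: UV.
  apply/propext; split=> -[g sg]; exists g; first exact: loewner_solution_eq_driver sg.
  by apply: loewner_solution_eq_driver sg => s /UVI ->.
have E : [set S : R | 0 <= S <= T /\ exists g, loewner_solution U z `[0, S[ g] =
         [set S : R | 0 <= S <= T /\ exists g, loewner_solution V z `[0, S[ g].
  have sub S : S <= T -> `[0, S[%classic `<=` `[0, T]%classic.
    by move=> ST x; rewrite /= !in_itv/= => /andP[-> /ltW xS]; exact: le_trans ST.
  apply/seteqP; split=> S [/andP[S0 ST] h]; (split; first by rewrite S0 ST).
    by rewrite -(iff _ (sub S ST)).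
  by rewrite (iff _ (sub S ST)).
have cases (P Q : Prop) (X Y : set R) : P = Q -> X = Y ->
    (if z == 0 then 0%E else if `[< P >] then +oo%E else ereal_sup [set S%:E | S in X]) =
    (if z == 0 then 0%E else if `[< Q >] then +oo%E else ereal_sup [set S%:E | S in Y]).
  by move=> -> ->.
exact: cases (iff _ (@subset_refl _ _)) E.
Qed.

Lemma total_variation_fin T U t : (total_variation 0 T U < +oo)%E -> 0 <= t -> t <= T ->
  total_variation 0 t U \is a fin_num.
Proof.
move=> bv t0 tT; rewrite ge0_fin_numE ?total_variation_ge0//.
apply: le_lt_trans bv; rewrite (total_variationD U t0 tT).
by rewrite leeDl// total_variation_ge0.
Qed.

Lemma fine_total_variationB T U s t : (total_variation 0 T U < +oo)%E ->
  0 <= s -> s <= t -> t <= T ->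
  total_variation s t U = (fine (total_variation 0 t U) - fine (total_variation 0 s U))%:E.
Proof.
move=> bv s0 st tT.
have ft := total_variation_fin bv (le_trans s0 st) tT.
have fs := total_variation_fin bv s0 (le_trans st tT).
by rewrite EFinB !fineK// (total_variationD U s0 st) addeAC subee// add0e.
Qed.

Lemma total_variation_dominates T U V t : (total_variation 0 T U < +oo)%E ->
  (forall s, 0 <= s -> s <= T -> V s = U s) -> t <= T ->
  dominates_increments (fun t => fine (total_variation 0 t U)) V 0 t.
Proof.
move=> bv VU tT u v u0 uv vt; have vT := le_trans vt tT.
rewrite !VU ?(le_trans u0 uv) ?(le_trans uv vT)//.
by rewrite -lee_fin -(fine_total_variationB bv)//; exact: total_variation_ge.
Qed.

(** The upper limit provides a constant below [2] valid near [t]. *)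
Lemma limsup_total_variation U T t : (total_variation 0 T U < +oo)%E -> 0 < t -> t <= T ->
  (limf_esup (fun s : R => total_variation (t - s) t U / (Num.sqrt s)%:E) 0^'+ < 2%:E)%E ->
  exists c s1, [/\ 0 <= c < 2, 0 < s1 <= t & forall s, 0 < s -> s <= s1 ->
    fine (total_variation 0 t U) - fine (total_variation 0 (t - s) U) <= c * Num.sqrt s].
Proof.
move=> bv t0 tT /ereal_inf_lt[_ [W W0 <-]].
set M := ereal_sup _ => M2.
have [c c02 Mc] : exists2 c : R, 0 <= c < 2 & (M <= c%:E)%E.
  move: M2; case: (M) => [r| |] //.
    rewrite lte_fin => r2; exists (Num.max r 0); last by rewrite lee_fin le_max lexx.
    by rewrite le_max lexx orbT gt_max r2 ltr0n.
  by exists 0; [rewrite lexx ltr0n|rewrite leNye].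
have [r /= r0 Hr] := W0.
exists c, (Num.min (r / 2) t); split => //.
  by rewrite lt_min divr_gt0// t0 ge_min lexx orbT.
move=> s s0; rewrite le_min => /andP[sr st].
have Ws : W s.
  apply: Hr => //; rewrite /ball/= sub0r normrN gtr0_norm//.
  by apply: le_lt_trans sr _; rewrite ltr_pdivrMr// mulr_natr mulr2n ltrDl.
have : (total_variation (t - s) t U / (Num.sqrt s)%:E <= c%:E)%E.
  by apply: le_trans Mc; apply: ereal_sup_ubound; exists s.
have ts0 : 0 <= t - s by rewrite subr_ge0.
have tst : t - s <= t by rewrite gerBl ltW.
have rs0 : 0 < Num.sqrt s by rewrite sqrtr_gt0.
rewrite (fine_total_variationB bv ts0 tst tT) inver gt_eqF// -EFinM lee_fin.
by rewrite ler_pdivrMr.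
Qed.

Lemma total_variation_rcontinuous U T t e : {within `[0, T], continuous U} ->
  (total_variation 0 T U < +oo)%E -> 0 <= t -> t < T -> 0 < e -> exists2 d, 0 < d &
    forall s, t <= s -> s <= T -> s - t < d ->
      fine (total_variation 0 s U) - fine (total_variation 0 t U) <= e.
Proof.
move=> cU bv t0 tT e0; have T0 : 0 < T by exact: le_lt_trans tT.
have BV : bounded_variation 0 T U.
  by apply/bounded_variationP; [exact: ltW|exact: (total_variation_fin bv (ltW T0) (lexx T))].
have /subspace_continuousP/(_ t) := total_variation_continuous T0 cU BV.
have t0T : 0 <= t <= T by rewrite t0 ltW.
move=> /(_ (mem_itvcc t0T))/cvg_withinP/(_ e e0)[k k0 Hk].
exists k => // s ts sT st.
have s0T : 0 <= s <= T by rewrite sT (le_trans t0 ts).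
have := Hk s (mem_itvcc s0T); rewrite ger0_norm ?subr_ge0// => /(_ st).
by rewrite ltr_norml => /andP[_ h]; exact: ltW.
Qed.

End Reduction.

Theorem theorem1p1 (R : realType) (T : R) (T_gt0 : 0 < T) (U : R -> R)
    (hU : BV_LR T U) :
  exists gamma : R -> R[i],
    [/\ is_trace T (loewner_chain T U) gamma,
        {in `[0, T] &, injective gamma} &
        forall t : R, 0 < t <= T -> upper_half_plane R (gamma t)].
Proof.
have [[cU U0] bv lr] := hU.
pose V t := U (clamp T t).
have VU t : 0 <= t -> t <= T -> V t = U t by move=> t0 tT; rewrite /V clamp_id.
have UV t : 0 <= t -> t <= T -> U t = V t by move=> t0 tT; rewrite VU.
have cV : continuous V by exact: continuous_clamp.
rewrite (loewner_chain_eq_driver UV).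
apply: (@simple_trace_of_subcritical R V (fun t => fine (total_variation 0 t U))) => //.
- by rewrite VU// ltW.
- move=> t t0 tT; split => //; first exact: total_variation_dominates VU tT.
  have t0T : 0 < t <= T by rewrite t0.
  exact: (limsup_total_variation bv t0 tT (lr t t0T)).
- by move=> t e t0 tT e0; exact: total_variation_rcontinuous.
Qed.
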